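(* There exist functions $a,b\in L^{\infty}(D^2)\cap H^{1}(D^2)$ such that the solution $\varphi$ with zero mean value on $D^2$ of the Neumann problem $$\begin{cases}-\Delta \varphi=\nabla a\cdot\nabla^{\perp}b & \text{in } D^2,\\ \partial_{\nu}\varphi=-a\,\partial_{\tau}b & \text{on } \partial D^2,\end{cases}$$ is not in $L^{\infty}(\overline{D^2})$.
   Context: $D^2=\{(x,y)\in\mathbb{R}^2: x^2+y^2<1\}$ is the open unit disk, $\nu$ is the outward unit normal to $\partial D^2$, $\tau$ is the counterclockwise unit tangent, and functions are real-valued. For $b$ on $D^2$, $\nabla^{\perp}b=(\partial_{x_2}b,-\partial_{x_1}b)$, so that $\nabla a\cdot\nabla^{\perp}b=\partial_{x_1}a\,\partial_{x_2}b-\partial_{x_2}a\,\partial_{x_1}b=\operatorname{div}(a\nabla^\perp b)$ and $\nu\cdot\nabla^{\perp}b=\partial_\tau b$ on $\partial D^2$ for smooth $a,b$. $H^1=W^{1,2}$. The problem is equivalent to $\operatorname{div}(\nabla \varphi+a\nabla^\perp b)=0$ in $D^2$ with $\nu\cdot(\nabla\varphi+a\nabla^\perp b)=0$ on $\partial D^2$, and the solution is understood in the corresponding weak sense: $\varphi\in W^{1,1}(D^2)$ with $\int_{D^2}\varphi\,dx=0$ and $$\int_{D^2}(\nabla\varphi+a\nabla^{\perp}b)\cdot\nabla v\,dx=0\qquad\text{for all } v\in C^{\infty}(\overline{D^2}).$$ *)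

(* Defs.v *)
From HB Require Import structures.
From mathcomp Require Import all_boot all_order all_algebra.
From mathcomp Require Import all_classical all_reals all_analysis.

Set Implicit Arguments.
Unset Strict Implicit.
Unset Printing Implicit Defensive.

Import Order.TTheory GRing.Theory Num.Theory.
Import numFieldNormedType.Exports.

Local Open Scope classical_set_scope.
Local Open Scope ring_scope.

Section Disk.
Context {R : realType}.
Implicit Types (p : \bar R) (k : nat) (e x : R * R).
Implicit Types (u g a b f eta v phi : R * R -> R).

Definition disk : set (R * R) := [set x | x.1 ^+ 2 + x.2 ^+ 2 < 1].

Definition lebesgue2 :
    {measure set (measurableTypeR R * measurableTypeR R) -> \bar R} :=
  (@lebesgue_measure R \x @lebesgue_measure R)%E.

Definition e1 : R * R := (1, 0).
Definition e2 : R * R := (0, 1).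

(* Only the partial derivatives of order exactly k are required to be continuous;
   continuity of those of lower order follows. *)
Fixpoint Ck k f : Prop :=
  if k is k'.+1 then
    forall e, e = e1 \/ e = e2 ->
      (forall x, derivable f x e) /\ Ck k' ('D_e f)
  else continuous f.

Definition smooth f : Prop := forall k, Ck k f.

Definition test_function f : Prop :=
  smooth f /\ exists K : set (R * R),
    [/\ compact K, K `<=` disk & forall x, ~ K x -> f x = 0].

(* Functions on the disk are represented by functions on the plane whose values
   outside the disk are ignored: [u \_ disk] extends [u] by zero. *)
Definition Lp_disk p u : Prop := u \_ disk \in Lfun lebesgue2 p.

Definition weak_derivative e u g : Prop := forall eta, test_function eta ->
  \int[lebesgue2]_(x in disk) (u x * 'D_e eta x) =
  - \int[lebesgue2]_(x in disk) (g x * eta x).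

Definition W1p_gradient p u g1 g2 : Prop :=
  [/\ Lp_disk p u, Lp_disk p g1, Lp_disk p g2,
      weak_derivative e1 u g1 & weak_derivative e2 u g2].

Definition W1p p u : Prop := exists g1 g2, W1p_gradient p u g1 g2.

(* With D the gradient and D^perp b = (D_2 b, - D_1 b), the last clause says that
   (D phi + a D^perp b) . D v has integral 0 over the disk.  The test functions v
   in C^oo(closed disk) are the restrictions of smooth functions on the plane. *)
Definition neumann_solution a b phi : Prop :=
  exists b1 b2 phi1 phi2,
    [/\ W1p_gradient 2%:E b b1 b2, W1p_gradient 1 phi phi1 phi2,
        \int[lebesgue2]_(x in disk) phi x = 0
      & forall v, smooth v ->
          \int[lebesgue2]_(x in disk)
            ((phi1 x + a x * b2 x) * 'D_e1 v x +
             (phi2 x - a x * b1 x) * 'D_e2 v x) = 0].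

End Disk.

(* Main.v *)
(* Take a = -1.  The integrand of the weak formulation then vanishes identically as
   soon as phi and b are harmonic conjugates.  Let
     L = 3 - log (1 - z) = A + i B,
   whose real part A is at least 1 on the disk; the conjugate functions
     phi = log |L|  and  b = arg L = atan (B / A)
   have a gradient of norm 1 / (|1 - z| |L|), whose square is integrable because of
   the logarithm, b is bounded, but phi tends to infinity at z = 1.

   Every other solution phi' is unbounded too.  Testing against a polynomial v whose
   normal derivative vanishes on the circle, a cutoff argument shows that the
   integral of phi' * Laplacian v does not depend on the solution; since the
   polynomials r^(2k) Re z^m are such Laplacians up to constants, all solutions have
   the same moments against (1 + x)^n.  These weights concentrate at z = 1, where
   phi is arbitrarily large, so phi' cannot be bounded. *)
Require Import Defs.
From mathcomp Require Import all_boot all_order all_algebra.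
From mathcomp Require Import all_classical all_reals all_analysis.
From mathcomp Require Import measurable_realfun ess_sup_inf.
From mathcomp Require Import ring lra.

Set Implicit Arguments.
Unset Strict Implicit.
Unset Printing Implicit Defensive.

Import Order.TTheory GRing.Theory Num.Theory.
Import numFieldNormedType.Exports.

Local Open Scope classical_set_scope.
Local Open Scope ring_scope.

(** With a constant, the interior equation is Laplace's, so the whole singularity comes from the
    boundary datum. A single logarithm would not do: the gradient of log |1 - z| has norm 1 / |1 -
    z|, whose square is not integrable near z = 1, and the outer logarithm supplies the missing
    factor. The constant 3 comes from |1 - z|^2 < 4 and log y < y, which give log |1 - z| < 2.

    The obstacle is that a competing solution is only W^{1,1}, comes with weak gradients of its own
    and has no trace on the circle, while weak derivatives are tested only on functions of compact
    support in the disk. Hence everything is an identity against polynomials: multiplied by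
    exp(-1/t) composed with a polynomial they become legitimate test functions, and a vanishing
    boundary condition is encoded algebraically, as divisibility by 1 - r^2. No integral over the
    circle ever occurs. *)

(** * Calculus of directional derivatives *)

Section DirectionalDerivative.
Context {R : realType} {V : normedModType R}.
Implicit Types (f g : V -> R) (x v : V).

(** Only derivatives in a fixed direction are used, never differentials in the plane; restricting to
    the line through [x] makes the one-variable chain rule available. *)
Lemma isder_line f x v a :
  is_derive x v f a <-> is_derive (0 : R) 1 (fun t => f (t *: v + x)) a.
Proof.
have E : (fun h => h^-1 *: ((f \o shift x) (h *: v) - f x)) =
  (fun h : R => h^-1 *: (((fun t => f (t *: v + x)) \o shift 0) (h *: 1)
     - f (0 *: v + x))).
  by apply/funext => t /=; rewrite addr0 scale0r add0r [t%:A]mulr1.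
by split=> -[df fa]; split; rewrite /derivable /derive ?E // -?E.
Qed.

Lemma isder_cst (c : R) x v : is_derive x v (fun=> c) (0 : R).
Proof. exact: is_derive_cst. Qed.

Lemma isderD f g x v a b : is_derive x v f a -> is_derive x v g b ->
  is_derive x v (fun z => f z + g z) (a + b).
Proof. exact: is_deriveD. Qed.

Lemma isderN f x v a : is_derive x v f a -> is_derive x v (fun z => - f z) (- a).
Proof. exact: is_deriveN. Qed.

Lemma isderM f g x v a b : is_derive x v f a -> is_derive x v g b ->
  is_derive x v (fun z => f z * g z) (f x * b + g x * a).
Proof. exact: is_deriveM. Qed.

Lemma isder_comp (h : R -> R) f x v a b : is_derive (f x) 1 h b ->
  is_derive x v f a -> is_derive x v (fun z => h (f z)) (b * a).
Proof.
move=> dh /isder_line df; apply/isder_line.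
apply: (@is_derive1_comp _ h (fun t => f (t *: v + x)) 0 b a).
by rewrite scale0r add0r.
Qed.

Lemma isder_near f g x v a : v != 0 -> (\forall z \near x, f z = g z) ->
  is_derive x v f a -> is_derive x v g a.
Proof. by move=> v0 fg; apply: near_eq_is_derive. Qed.

End DirectionalDerivative.

Section Line.
Context {R : realType}.
Implicit Types (f : R * R -> R) (x : R * R).

Lemma isder_affine (c d t : R) : is_derive t (1 : R) (fun t => t * c + d) c.
Proof.
have := isderD (isderM (is_derive_id t (1 : R)) (isder_cst c t 1)) (isder_cst d t 1).
by rewrite mulr0 mulr1 add0r addr0.
Qed.

Lemma isder_fst x (v : R * R) : is_derive x v (fun z => z.1) v.1.
Proof. by apply/isder_line; exact: isder_affine. Qed.

Lemma isder_snd x (v : R * R) : is_derive x v (fun z => z.2) v.2.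
Proof. by apply/isder_line; exact: isder_affine. Qed.

Lemma isder_row f (x y a : R) : is_derive (x, y) e1 f a ->
  is_derive x (1 : R) (fun t => f (t, y)) a.
Proof.
move=> /isder_line fa; apply/isder_line; move: fa.
congr is_derive; apply/funext => t; congr f.
by rewrite /e1 /=; apply/pair_equal_spec; split=> //=; rewrite scaler0 add0r.
Qed.

Lemma isder_col f (x y a : R) : is_derive (x, y) e2 f a ->
  is_derive y (1 : R) (fun t => f (x, t)) a.
Proof.
move=> /isder_line fa; apply/isder_line; move: fa.
congr is_derive; apply/funext => t; congr f.
by rewrite /e2 /=; apply/pair_equal_spec; split=> //=; rewrite scaler0 add0r.
Qed.

End Line.

(** * Polynomial functions of two variables *)

Section Polynomials.
Context {R : realType}.
Implicit Types (f g w : R * R -> R) (x : R * R).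

(** A predicate on functions rather than a formal object, so that closure under differentiation, and
    hence smoothness, is an induction on the way the function is built. *)
Inductive pol : (R * R -> R) -> Prop :=
| pol_cst c : pol (fun=> c)
| pol_fst : pol (fun z => z.1)
| pol_snd : pol (fun z => z.2)
| polD f g : pol f -> pol g -> pol (fun z => f z + g z)
| polM f g : pol f -> pol g -> pol (fun z => f z * g z).

Lemma polN f : pol f -> pol (fun z => - f z).
Proof.
move=> pf; rewrite (_ : (fun _ => _) = fun z => (-1) * f z).
  by apply: polM => //; exact: pol_cst.
by apply/funext => z; rewrite mulN1r.
Qed.

Lemma polB f g : pol f -> pol g -> pol (fun z => f z - g z).
Proof. by move=> pf pg; apply: polD => //; exact: polN. Qed.

Lemma polX f n : pol f -> pol (fun z => f z ^+ n).
Proof.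
move=> pf; elim: n => [|n IH].
  rewrite (_ : (fun _ => _) = fun=> 1); first exact: pol_cst.
  by apply/funext => z; rewrite expr0.
rewrite (_ : (fun _ => _) = fun z => f z * f z ^+ n); first exact: polM.
by apply/funext => z; rewrite exprS.
Qed.

Lemma continuous_pol f : pol f -> continuous f.
Proof.
elim=> {f} [c||| f g _ cf _ cg | f g _ cf _ cg] x.
- exact: cvg_cst.
- exact: cvg_fst.
- exact: cvg_snd.
- exact: (@cvgD _ _ _ _ _ f g _ _ (cf x) (cg x)).
- exact: (@cvgM _ _ _ _ f g _ _ (cf x) (cg x)).
Qed.

Lemma pol_derivable f : pol f ->
  forall v, (forall x, derivable f x v) /\ pol ('D_v f).
Proof.
move=> pf v; suff [g pg fg] : exists2 g, pol g & forall x, is_derive x v f (g x).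
  split=> [x|]; first by case: (fg x).
  by rewrite (_ : 'D_v f = g)//; apply/funext => x; case: (fg x).
elim: pf => {f} [c||| f g pf [df pdf fdf] pg [dg pdg gdg]
                    | f g pf [df pdf fdf] pg [dg pdg gdg]].
- by exists (fun=> 0) => [|x]; [exact: pol_cst | exact: isder_cst].
- by exists (fun=> v.1) => [|x]; [exact: pol_cst | exact: isder_fst].
- by exists (fun=> v.2) => [|x]; [exact: pol_cst | exact: isder_snd].
- exists (fun z => df z + dg z) => [|x]; first exact: polD.
  exact: isderD.
- exists (fun z => f z * dg z + g z * df z) => [|x]; last exact: isderM.
  by apply: polD; exact: polM.
Qed.

Lemma pol_isder f v x : pol f -> is_derive x v f ('D_v f x).
Proof. by move=> /pol_derivable/(_ v)[df _]; exact: derivableP. Qed.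

Lemma polDer f v : pol f -> pol ('D_v f).
Proof. by move=> /pol_derivable/(_ v)[]. Qed.

Lemma smooth_pol f : pol f -> smooth f.
Proof.
move=> pf k; elim: k f pf => [|k IH] f pf /=; first exact: continuous_pol.
by move=> e _; have [df pdf] := pol_derivable pf e; split => //; exact: IH.
Qed.

End Polynomials.

(** * The flat functions t^(-k) exp(-1/t) *)

Section Flat.
Context {R : realType}.
Implicit Types (k : nat) (s t : R).

Lemma isderV {V : normedModType R} (f : V -> R) x v a : f x != 0 ->
  is_derive x v f a -> is_derive x v (fun y => (f y)^-1) (- (f x) ^- 2 * a).
Proof.
move=> fx0 [df <-]; split; first exact: derivableV.
by rewrite deriveV.
Qed.

Lemma isderX {V : normedModType R} (f : V -> R) n x v a :
  is_derive x v f a -> is_derive x v (fun y => f y ^+ n) (n%:R * f x ^+ n.-1 * a).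
Proof.
move=> df; apply: (@isder_comp _ _ (fun y => y ^+ n)) => //.
split; first exact: exprn_derivable.
by rewrite exp_derive -[LHS]mulrA mulr1.
Qed.

(** The powers of 1/t are indexed so that the family spans a space stable under differentiation. At
    infinity index 0 tends to 1, which gives the cutoff, and the higher indices, which occur in its
    derivatives, tend to 0. *)
Definition flat k t : R := if 0 < t then t^-1 ^+ k * expR (- t^-1) else 0.

Lemma flat_ge0 k t : 0 <= flat k t.
Proof.
by rewrite /flat; case: ifPn => // t0; rewrite mulr_ge0 ?expR_ge0 ?exprn_ge0 ?invr_ge0 ?ltW.
Qed.

Lemma flat_le0 k t : t <= 0 -> flat k t = 0.
Proof. by move=> t0; rewrite /flat ltNge t0. Qed.

Lemma expr_le_expR k s : 0 <= s -> s ^+ k <= k`!%:R * expR s.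
Proof.
case: k => [|k] s0; first by rewrite expr0 mul1r -expR0 ler_expR.
rewrite -ler_pdivrMl ?ltr0n ?fact_gt0// mulrC.
by apply: (le_trans _ (expR_ge1Dxn k s0)); rewrite lerDr.
Qed.

Lemma flat_bounded k t : flat k t <= k`!%:R.
Proof.
rewrite /flat; case: ifPn => t0; last by rewrite ler0n.
by rewrite expRN ler_pdivrMr ?expR_gt0// expr_le_expR// invr_ge0 ltW.
Qed.

(** Trades a factor [t] for one power of 1/t. This gives the smallness at 0, the decay at infinity,
    and later absorbs the factor by which the gradient of the cutoff blows up. *)
Lemma flatS k t : t * flat k.+1 t = flat k t.
Proof.
rewrite /flat; case: ifPn => t0; last by rewrite mulr0.
by rewrite exprS !mulrA mulfV ?mul1r// gt_eqF.
Qed.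

Lemma flat_small k t : `|flat k t| <= k.+1`!%:R * `|t|.
Proof.
rewrite -flatS normrM mulrC ler_wpM2r// ger0_norm ?flat_ge0//.
exact: flat_bounded.
Qed.

Lemma isder_flat k t : is_derive t 1 (flat k) (flat k.+2 t - k%:R * flat k.+1 t).
Proof.
have [t0|t0|->] := ltgtP t 0.
- rewrite !flat_le0 ?ltW// mulr0 subr0.
  apply: (isder_near (f := fun=> 0)); first exact: oner_neq0.
  by near=> z; rewrite flat_le0// ltW//; near: z; exact: lt_nbhsl.
- have tn0 : t != 0 by rewrite gt_eqF.
  have dV : is_derive t (1 : R) (fun z => z^-1) (- t ^- 2 * 1).
    by apply: isderV => //; exact: is_derive_id.
  have dX : is_derive t (1 : R) (fun z => z^-1 ^+ k)
      (k%:R * t^-1 ^+ k.-1 * (- t ^- 2 * 1)).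
    exact: (isderX k dV).
  have dE := isder_comp (is_derive_expR _) (isderN dV).
  apply: (isder_near _ _ (is_derive_eq (isderM dX dE) _)).
  + exact: oner_neq0.
  + near=> z; rewrite /flat ifT//; near: z; exact: lt_nbhsr.
  rewrite /flat t0 mulr1 -exprVn !exprS.
  case: k {dX dE} => [|k]; first by rewrite !mul0r !mulr0 subr0 addr0 expr0; ring.
  by rewrite /= exprS; ring.
- rewrite !flat_le0// mulr0 subr0.
  suff H : h^-1 *: (flat k (h *: 1 + 0) - flat k 0) @[h --> (0 : R)^'] --> (0 : R).
    by split; [apply/cvg_ex; exists 0 | apply: cvg_lim].
  (* By [flatS] the difference quotient at 0 is again a flat function, which is O(|h|). *)
  apply: (@cvg_trans _ (flat k.+1 h @[h --> (0 : R)^'])).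
    apply: near_eq_cvg; near=> h.
    rewrite [flat k 0]flat_le0// subr0 addr0 [h *: 1]mulr1 -(flatS k) scalerA.
    rewrite mulVf ?scale1r//; near: h; exact: nbhs_dnbhs_neq.
  apply/norm_cvg0P.
  apply: (@squeeze_cvgr _ _ _ _ (fun=> 0) (fun h => k.+2`!%:R * `|h|)).
  + by near=> h; rewrite normr_ge0 flat_small.
  + exact: cvg_cst.
  + rewrite -[X in _ --> X](mulr0 (k.+2`!%:R)); apply: cvgMr.
    rewrite -[X in _ --> X](@normr0 _ R); apply: cvg_norm; exact: cvg_within.
Unshelve. all: by end_near. Qed.

Lemma continuous_flat k : continuous (flat k).
Proof.
move=> t; apply: differentiable_continuous; apply/derivable1_diffP.
by have [] := isder_flat k t.
Qed.

Lemma flat_cvg0 k (u : R^nat) : u @ \oo --> +oo -> flat k.+1 (u n) @[n --> \oo] --> (0 : R).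
Proof.
move=> uy; have u0 : \forall n \near \oo, 0 < u n by exact: (cvgryPgt _).1.
apply: (@squeeze_cvgr _ _ _ _ (fun=> 0) (fun n => k`!%:R * (u n)^-1)).
- near=> n; rewrite flat_ge0/= ler_pdivlMr; last by near: n.
  by rewrite mulrC flatS flat_bounded.
- exact: cvg_cst.
- rewrite -[X in _ --> X](mulr0 (k`!%:R)); apply: cvgMr.
  exact/(gtr0_cvgV0 u0).
Unshelve. all: by end_near. Qed.

Lemma flat_cvg1 (u : R^nat) : u @ \oo --> +oo -> flat 0 (u n) @[n --> \oo] --> (1 : R).
Proof.
move=> uy; have u0 : \forall n \near \oo, 0 < u n by exact: (cvgryPgt _).1.
apply: (@cvg_trans _ (expR (- (u n)^-1) @[n --> \oo])).
  apply: near_eq_cvg; near=> n; rewrite /flat ifT ?expr0 ?mul1r//; by near: n.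
rewrite -expR0; apply: continuous_cvg; first exact: continuous_expR.
by rewrite -oppr0; apply: cvgN; exact/(gtr0_cvgV0 u0).
Unshelve. all: by end_near. Qed.

End Flat.

(** * Smooth cutoffs exhausting the disk *)

Section FlatPolynomials.
Context {R : realType}.
Implicit Types (p f w : R * R -> R).

(* The span of the [flat k \o p * w] is stable under differentiation. *)
Inductive flatpol p : (R * R -> R) -> Prop :=
| flatpol_term k w : pol w -> flatpol p (fun z => flat k (p z) * w z)
| flatpolD f g : flatpol p f -> flatpol p g -> flatpol p (fun z => f z + g z).

Lemma isder_flatpol_term p k w v x : pol p -> pol w ->
  is_derive x v (fun z => flat k (p z) * w z)
    (flat k (p x) * 'D_v w x +
     flat k.+2 (p x) * ('D_v p x * w x) + flat k.+1 (p x) * (- k%:R * 'D_v p x * w x)).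
Proof.
move=> pp pw.
have dp := isder_comp (isder_flat k (p x)) (pol_isder v x pp).
by apply: (is_derive_eq (isderM dp (pol_isder v x pw))); ring.
Qed.

Lemma smooth_flatpol p f : pol p -> flatpol p f -> smooth f.
Proof.
move=> pp pf k; elim: k f pf => [|k IH] f pf /=.
  elim: pf => {f} [k w pw|f g _ cf _ cg] x.
    apply: (@cvgM _ _ _ _ (fun z => flat k (p z)) w).
      apply: (@continuous_comp _ _ _ p (flat k)); first exact: continuous_pol.
      exact: continuous_flat.
    exact: continuous_pol.
  exact: (@cvgD _ _ _ _ _ f g _ _ (cf x) (cg x)).
move=> e _; suff [g pg fg] : exists2 g, flatpol p g & forall x, is_derive x e f (g x).
  split=> [x|]; first by case: (fg x).
  by rewrite (_ : 'D_e f = g); [exact: IH | apply/funext => x; case: (fg x)].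
elim: pf => {f} [l w pw|f g _ [df pdf fdf] _ [dg pdg gdg]].
  exists (fun x => (flat l (p x) * 'D_e w x +
     flat l.+2 (p x) * ('D_e p x * w x)) + flat l.+1 (p x) * (- l%:R * 'D_e p x * w x)).
    have pDp := polDer e pp; have pDw := polDer e pw.
    apply: flatpolD; first apply: flatpolD; apply: flatpol_term => //.
      exact: polM.
    by apply: polM => //; apply: polM => //; exact: pol_cst.
  by move=> x; exact: isder_flatpol_term.
exists (fun z => df z + dg z); first exact: flatpolD.
by move=> x; exact: isderD.
Qed.

End FlatPolynomials.

Section Cutoff.
Context {R : realType}.
Implicit Types (w : R * R -> R) (n : nat) (z : R * R).

Definition rim z : R := 1 - (z.1 ^+ 2 + z.2 ^+ 2).

(** The shift by 1 keeps the support of [flat 0 (cutarg n z)] inside the compact set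
    [rim z >= 1 / n.+1]; without it the support would reach the circle. *)
Definition cutarg n z : R := n.+1%:R * rim z - 1.

Lemma pol_rim : pol rim.
Proof.
apply: polB; first exact: pol_cst.
by apply: polD; apply: polX; [exact: pol_fst | exact: pol_snd].
Qed.

Lemma pol_cutarg n : pol (cutarg n).
Proof.
apply: polB; last exact: pol_cst.
by apply: polM; [exact: pol_cst | exact: pol_rim].
Qed.

Lemma disk_rim z : disk z <-> 0 < rim z.
Proof. by rewrite /disk /rim /=; split=> ?; lra. Qed.

Lemma compact_superlevel_cutarg n : compact [set z : R * R | 0 <= cutarg n z].
Proof.
apply: (subclosed_compact (B := (`[-1, 1] : set R) `*` (`[-1, 1] : set R))).
- rewrite (_ : [set _ | _] = cutarg n @^-1` [set y | 0 <= y])//.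
  apply: closed_comp; last exact: closed_ge.
  by move=> z _; apply: continuous_pol; exact: pol_cutarg.
- by apply: compact_setX; exact: segment_compact.
- move=> z /=; rewrite /cutarg subr_ge0 => h.
  have r0 : 0 <= rim z by rewrite -(pmulr_rge0 _ (ltr0Sn R n)); apply: le_trans h.
  rewrite !in_itv/=; move: r0; rewrite /rim => r0.
  by split; apply/andP; split; nra.
Qed.

Lemma test_function_cutoff n w : pol w ->
  test_function (fun z => flat 0 (cutarg n z) * w z).
Proof.
move=> pw; split.
  by apply: (smooth_flatpol (pol_cutarg n)); exact: flatpol_term.
exists [set z | 0 <= cutarg n z]; split.
- exact: compact_superlevel_cutarg.
- move=> z /=; rewrite /cutarg subr_ge0 => h; apply/disk_rim.
  by rewrite -(pmulr_rgt0 _ (ltr0Sn R n)); apply: lt_le_trans h.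
- by move=> z /= /negP; rewrite -ltNge => h; rewrite flat_le0 ?mul0r// ltW.
Qed.

Lemma derive_cutoff n w v z : pol w ->
  'D_v (fun z => flat 0 (cutarg n z) * w z) z =
  flat 0 (cutarg n z) * 'D_v w z +
  flat 2 (cutarg n z) * ('D_v (cutarg n) z * w z).
Proof.
move=> pw; have [_ ->] := isder_flatpol_term 0 v z (pol_cutarg n) pw.
by rewrite mulNr mul0r oppr0 !mul0r mulr0 addr0.
Qed.

Lemma cvg_cutarg z : disk z -> cutarg n z @[n --> \oo] --> +oo.
Proof.
move=> /disk_rim r0; apply/cvgryPge => A; near=> n.
rewrite /cutarg lerBrDr -ler_pdivrMr// (@le_trans _ _ n%:R)//; last by rewrite ler_nat.
by near: n; exact: nbhs_infty_ger.
Unshelve. all: by end_near. Qed.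

Lemma derive_rim (v : R * R) z : 'D_v rim z = - (2 * z.1 * v.1 + 2 * z.2 * v.2).
Proof.
have d1 := isderX 2 (isder_fst z v); have d2 := isderX 2 (isder_snd z v).
have [_ ->] := isderD (isder_cst 1 z v) (isderN (isderD d1 d2)).
by rewrite add0r.
Qed.

Lemma derive_cutarg n v z : 'D_v (cutarg n) z = n.+1%:R * 'D_v rim z.
Proof.
have d1 := isderM (isder_cst n.+1%:R z v) (pol_isder v z pol_rim).
have [_ ->] := isderD d1 (isder_cst (-1) z v).
by rewrite mulr0 !addr0.
Qed.

End Cutoff.

(** * Borel sets of the plane and the product sigma-algebra *)

Section ProductMeasurability.
Context {R : realType}.
Let T : measurableType _ := (measurableTypeR R * measurableTypeR R)%type.

(** An open set is the countable union of the squares with rational centre and radius that it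
    contains; the other squares are replaced by the empty set. *)
Lemma open_measurable2 (O : set (R * R)) : open O -> measurable (O : set T).
Proof.
move=> oO.
pose B (p q r : rat) : set (R * R) := ball (ratr p : R) (ratr r) `*` ball (ratr q : R) (ratr r).
rewrite (_ : O = \bigcup_(p : rat) \bigcup_(q : rat) \bigcup_(r : rat)
   if `[< B p q r `<=` O >] then B p q r else set0).
  apply: bigcupT_measurable_rat => p; apply: bigcupT_measurable_rat => q.
  apply: bigcupT_measurable_rat => r; case: ifPn => _; last exact: measurable0.
  by apply: measurableX; apply: open_measurable; exact: ball_open.
apply/seteqP; split=> [[x y] Oxy|z].
  have /nbhs_ballP[e /= e0 sub] : nbhs (x, y) O by exact: open_nbhs_nbhs.
  have [r /andP[r0 re]] : exists r : rat, 0 < (ratr r : R) < e / 2.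
    have /rat_in_itvoo[r] : (0 : R) < e / 2 by rewrite divr_gt0.
    by rewrite in_itv/= => ?; exists r.
  have hx (u : R) : exists p : rat, ball (ratr p : R) (ratr r) u.
    have /rat_in_itvoo[p] : u - ratr r < u by rewrite gtrBl.
    rewrite in_itv/= => /andP[p1 p2]; exists p.
    by rewrite /ball/= ltr_norml; apply/andP; split; lra.
  have [p hp] := hx x; have [q hq] := hx y.
  exists p => //; exists q => //; exists r => //.
  rewrite ifT//; apply/asboolP => -[u v] [/= hu hv]; apply: sub.
  have tri (a s t : R) : ball a (ratr r) s -> ball a (ratr r) t -> ball s e t.
    rewrite /ball/= !ltr_norml => /andP[? ?] /andP[? ?].
    by apply/andP; split; lra.
  by split; [exact: tri hp hu | exact: tri hq hv].
by move=> [p _ [q _ [r _]]]; case: asboolP => // h /h.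
Qed.

Lemma continuous_measurable2 (f : R * R -> R) : continuous f ->
  measurable_fun setT (f : T -> R).
Proof.
move=> cf; apply: (measurability _ (RGenOInfty.measurableE R)) => //.
move=> _ [_ [x ->] <-]; rewrite setTI; apply: open_measurable2.
by apply: open_comp; [move=> z _; exact: cf | exact: interval_open].
Qed.

Lemma open_continuous_measurable2 (U : set (R * R)) (f : R * R -> R) : open U ->
  (forall z, U z -> {for z, continuous f}) -> measurable_fun (U : set T) (f : T -> R).
Proof.
move=> oU cf; apply: (measurability _ (RGenOInfty.measurableE R)) => //.
move=> _ [_ [x ->] <-]; apply: open_measurable2.
rewrite openE => z [Uz fz]; apply: filterI; first exact: open_nbhs_nbhs.
by apply: cf => //; apply: open_nbhs_nbhs; split => //; exact: interval_open.
Qed.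

End ProductMeasurability.

(** * Integration and Lebesgue spaces on the disk *)

Section DiskIntegration.
Context {R : realType}.
Notation mu := (@lebesgue2 R).
Notation T2 := (measurableTypeR R * measurableTypeR R)%type.
Notation D := (@disk R : set T2).
Implicit Types (f g k : R * R -> R).

Lemma open_disk : open D.
Proof.
rewrite (_ : D = @rim R @^-1` [set y | 0 < y]); last first.
  apply/seteqP; split=> z h; exact/disk_rim.
apply: open_comp; last exact: open_gt.
by move=> z _; apply: continuous_pol; exact: pol_rim.
Qed.

Lemma measurable_disk : measurable D.
Proof. by apply: open_measurable2; exact: open_disk. Qed.
Hint Resolve measurable_disk : core.

Lemma lebesgue2X (A B : set (measurableTypeR R)) : measurable A -> measurable B ->
  mu (A `*` B) = (lebesgue_measure A * lebesgue_measure B)%E.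
Proof.
exact: (@product_measure1E _ _ (measurableTypeR R) (measurableTypeR R) R
  lebesgue_measure lebesgue_measure).
Qed.

Lemma lebesgue2_box_gt0 (A : set T2) (a b c d : R) : a < b -> c < d ->
  measurable A -> `]a, b[ `*` `]c, d[ `<=` A -> (0 < mu A)%E.
Proof.
move=> ab cd mA sub; apply: (@lt_le_trans _ _ (mu (`]a, b[ `*` `]c, d[))).
  rewrite lebesgue2X// !lebesgue_measure_itv/= !lte_fin ab cd.
  by rewrite -!EFinB -EFinM lte_fin mulr_gt0 ?subr_gt0.
by apply: le_measure => //; rewrite inE//; apply: measurableX.
Qed.

Lemma lebesgue2_disk_lty : (mu D < +oo)%E.
Proof.
apply: (@le_lt_trans _ _ (mu (`]-1, 1[ `*` `]-1, 1[))).
  apply: le_measure; rewrite ?inE//; first exact: measurableX.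
  move=> z; rewrite /disk/= => h; rewrite !in_itv/=.
  by split; apply/andP; split; nra.
rewrite lebesgue2X// !lebesgue_measure_itv/=.
by case: ifP => _; rewrite -?EFinB -?EFinM ltry.
Qed.

Lemma lebesgue2_disk_fin : mu D = (fine (mu D))%:E.
Proof. by rewrite fineK// ge0_fin_numE// lebesgue2_disk_lty. Qed.

Definition integ f := mu.-integrable D (EFin \o f).

Lemma integ_meas f : integ f -> measurable_fun D f.
Proof. by move=> /integrableP[/measurable_EFinP]. Qed.

Lemma integ_le f g : measurable_fun D f -> integ g ->
  (forall z, D z -> `|f z| <= g z) -> integ f.
Proof.
move=> mf ig fg; apply: (le_integrable _ _ _ ig) => //; first exact/measurable_EFinP.
by move=> z Dz /=; rewrite lee_fin (le_trans (fg z Dz))// ler_norm.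
Qed.

Lemma integ_cst c : integ (fun=> c).
Proof.
apply/integrableP; split; first exact/measurable_EFinP/measurable_cst.
rewrite (eq_integral (cst `|c|%:E))// integral_cst// lebesgue2_disk_fin.
by rewrite -EFinM ltry.
Qed.

Lemma integD f g : integ f -> integ g -> integ (fun z => f z + g z).
Proof. by move=> fi gi; have := integrableD measurable_disk fi gi. Qed.

Lemma integZ c f : integ f -> integ (fun z => c * f z).
Proof. by move=> fi; have := integrableZl measurable_disk c fi. Qed.

Lemma integB f g : integ f -> integ g -> integ (fun z => f z - g z).
Proof. by move=> fi gi; have := integrableB measurable_disk fi gi. Qed.

Lemma integM f k C : integ f -> measurable_fun D k ->
  (forall z, D z -> `|k z| <= C) -> integ (fun z => f z * k z).
Proof.
move=> fi mk kC; apply: (@integ_le _ (fun z => C * `|f z|)).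
- by apply: measurable_funM => //; exact: integ_meas.
- by apply: integZ; have := integrable_norm fi.
- by move=> z Dz; rewrite normrM mulrC ler_wpM2r// kC.
Qed.

(** Dominated convergence with dominating function [C * |f|]: the form suited to a fixed integrable
    factor against uniformly bounded weights. *)
Lemma cvg_Rint f (k_ : nat -> R * R -> R) k (C : R) :
  integ f -> (forall n, measurable_fun D (k_ n)) ->
  measurable_fun D k ->
  (forall n z, D z -> `|k_ n z| <= C) ->
  (forall z, D z -> k_ n z @[n --> \oo] --> k z) ->
  \int[mu]_(z in D) (f z * k_ n z) @[n --> \oo] --> \int[mu]_(z in D) (f z * k z).
Proof.
move=> fi mk_ mk kC kk.
have mf := integ_meas fi.
have [] := @dominated_convergence _ _ _ mu D measurable_disk
  (fun n z => (f z * k_ n z)%:E) (fun z => (f z * k z)%:E) (fun z => (C * `|f z|)%:E).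
- by move=> n; apply/measurable_EFinP; exact: measurable_funM.
- by apply/measurable_EFinP; exact: measurable_funM.
- apply: aeW => z Dz; apply: cvg_EFin; first exact: nearW.
  by apply: cvgMr; exact: kk.
- by apply: integZ; have := integrable_norm fi.
- by apply: aeW => z n Dz; rewrite lee_fin normrM mulrC ler_wpM2r// kC.
move=> ik _; rewrite -(fineK (integrable_fin_num measurable_disk ik)).
exact: fine_cvg.
Qed.

Lemma Lp_disk1P f : Lp_disk 1 f <-> integ f.
Proof.
rewrite /Lp_disk /integ integrable_mkcond// restrict_EFin.
by split=> /Lfun1_integrable.
Qed.

Lemma Lp_disk_meas p f : Lp_disk p f -> measurable_fun D f.
Proof.
rewrite /Lp_disk => /sub_Lfun_mfun; rewrite inE/= => mf.
by apply/(measurable_restrictT _ measurable_disk).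
Qed.

(** The disk has finite measure and |f| <= 1 + f^2. *)
Lemma Lp_disk2_integ f : Lp_disk 2%:E f -> integ f.
Proof.
move=> f2; have mf := Lp_disk_meas f2.
have := Lfun2_integrable_sqr f2 => h.
have hi : integ (fun z => f z ^+ 2).
  apply: (@eq_integrable _ _ _ mu D measurable_disk (fun z => ((f \_ D) z ^+ 2)%:E)).
    by move=> z zD /=; rewrite patchE zD.
  by apply: integrableS h.
apply: (@integ_le _ (fun z => 1 + f z ^+ 2)) => //.
  by apply: integD => //; exact: integ_cst.
move=> z _; rewrite -[f z ^+ 2]real_normK ?num_real//.
by have := sqr_ge0 (`|f z| - 1); have := normr_ge0 (f z); nra.
Qed.

Lemma Lp_disk2_le f g : measurable_fun D f -> integ g ->
  (forall z, D z -> f z ^+ 2 <= g z) -> Lp_disk 2%:E f.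
Proof.
move=> mf ig fg; rewrite /Lp_disk inE; apply/andP; split; rewrite inE/=.
  exact/(measurable_restrictT _ measurable_disk).
have i2 : integ (fun z => f z ^+ 2).
  apply: (@integ_le _ g) => //; first exact: measurable_funX.
  by move=> z Dz; rewrite ger0_norm ?sqr_ge0// fg.
rewrite /finite_norm unlock; apply: poweR_lty.
have /integrableP[_] := i2; apply: le_lt_trans; rewrite [leRHS]integral_mkcond.
rewrite le_eqVlt; apply/orP; left; apply/eqP; apply: eq_integral => z _ /=.
rewrite !patchE; case: ifPn => _ /=.
  by rewrite powR_mulrn// normrX.
by rewrite normr0 powR0.
Qed.

(** The norm of exponent infinity is an essential supremum only when the whole space has positive
    measure. *)
Lemma lebesgue2_setT_gt0 : (0 < mu setT)%E.
Proof. exact: (@lebesgue2_box_gt0 setT 0 1 0 1). Qed.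

Lemma Lp_disky_le f C : measurable_fun D f ->
  (forall z, D z -> `|f z| <= C) -> Lp_disk +oo%E f.
Proof.
move=> mf fC; rewrite /Lp_disk inE; apply/andP; split; rewrite inE/=.
  exact/(measurable_restrictT _ measurable_disk).
rewrite /finite_norm unlock lebesgue2_setT_gt0.
(* The extension takes the value 0 off the disk, and [C] is not assumed nonnegative. *)
apply: (@le_lt_trans _ _ (Num.max 0 C)%:E); last exact: ltry.
apply/ess_supP/aeW => z /=; rewrite lee_fin le_max patchE.
by case: ifPn => [/set_mem/fC ->|_]; rewrite ?orbT// normr0 lexx.
Qed.

Lemma Lp_disky_bounded f : Lp_disk +oo%E f ->
  exists M : R, {ae mu, forall z, D z -> `|f z| <= M}.
Proof.
rewrite /Lp_disk => /sub_Lfun_finLfun; rewrite inE/= /finite_norm unlock.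
rewrite lebesgue2_setT_gt0; set h := abse \o _.
have := ess_sup_ge mu h; case: (ess_sup mu h) => [r hr _|//|hN _].
- exists r; move: hr; apply: filterS => z + Dz; rewrite /h /= lee_fin patchE.
  by rewrite mem_set.
- by exists 0; move: hN; apply: filterS => z; rewrite /h /= leeNy_eq.
Qed.

End DiskIntegration.

(** * Classical derivatives are weak derivatives *)

Section CompactSupport.
Context {R : realType}.
Notation T1 := (measurableTypeR R).
Notation T2 := (measurableTypeR R * measurableTypeR R)%type.
Notation mu := (@lebesgue2 R).
Notation leb := (@lebesgue_measure R).
Notation D := (@disk R : set T2).
Implicit Types (f g F G : R * R -> R) (z : R * R).

Definition box : set (R * R) := (`[-1, 1] : set R) `*` (`[-1, 1] : set R).

Lemma disk_box : D `<=` box.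
Proof. by move=> z; rewrite /disk /box /= !in_itv/= => ?; split; apply/andP; split; nra. Qed.

Lemma compact_box : compact box.
Proof. by apply: compact_setX; exact: segment_compact. Qed.

Lemma continuous_bounded_box G : continuous G ->
  exists C : R, forall z, box z -> `|G z| <= C.
Proof.
move=> cG; have [||c _ cM] := @compact_EVT_max _ R (fun z => `|G z|) box _ compact_box.
- by exists 0; rewrite /box/= !in_itv/= oppr_le0 ler01.
- apply: continuous_subspaceT => z; apply: (@continuous_comp _ _ _ G); first exact: cG.
  exact: norm_continuous.
- by exists `|G c| => z zb; apply: cM; rewrite inE.
Qed.

Lemma integrable_box G : continuous G -> (forall z, ~ box z -> G z = 0) ->
  mu.-integrable setT (EFin \o G).
Proof.
move=> cG G0.
have mG : measurable_fun (setT : set T2) (G : T2 -> R) by exact: continuous_measurable2.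
have mbox : measurable (box : set T2) by exact: measurableX.
have [M GM] := continuous_bounded_box cG.
have -> : EFin \o G = (EFin \o G) \_ box.
  apply/funext => z; rewrite patchE; case: ifPn => // /negP zb /=.
  by rewrite G0// => /mem_set.
apply: (integrable_mkcond _ mbox).1.
apply: measurable_bounded_integrable => //.
- rewrite lebesgue2X// !lebesgue_measure_itv/=.
  by case: ifP => _; rewrite -?EFinB -?EFinM ltry.
- exact: measurable_funTS.
- by exists M; split; [exact: num_real|move=> x Mx z bz; apply: (le_trans (GM z bz)); exact: ltW].
Qed.

(** The bound is 2 rather than 1 because in the applications vanishing is known only off the closed
    square, so nothing is known at the points -1 and 1; at -2 and 2 the primitive is 0. *)
Lemma line_integral0 (h dh : R -> R) : continuous dh ->
  (forall t, is_derive t (1 : R) h (dh t)) ->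
  (forall t, `|t| >= 2 -> h t = 0) -> (forall t, `|t| >= 2 -> dh t = 0) ->
  (\int[leb]_t (dh t)%:E = 0)%E.
Proof.
move=> cdh hd h0 dh0.
have dth t : derivable h t 1 by case: (hd t).
have ch : continuous h.
  by move=> t; apply: differentiable_continuous; exact/derivable1_diffP.
have -> : (\int[leb]_t (dh t)%:E = \int[leb]_(t in `[(-2)%R, 2%R]) (dh t)%:E)%E.
  rewrite [RHS]integral_mkcond; apply: eq_integral => t _.
  rewrite patchE; case: ifPn => // /negP tb; rewrite dh0//.
  rewrite leNgt ltr_norml; apply/negP => /andP[? ?]; apply: tb.
  by rewrite inE/= in_itv/= !ltW.
rewrite (@continuous_FTC2 _ dh h).
- by rewrite !h0 ?normrN ?ger0_norm// subee.
- lra.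
- exact: continuous_subspaceT.
- split => [t _||]; first exact: dth.
    by apply: cvg_at_right_filter; exact: ch.
  by apply: cvg_at_left_filter; exact: ch.
- by move=> t _; rewrite derive1E; case: (hd t).
Qed.

Lemma box_ge2 (x y : R) : `|x| >= 2 \/ `|y| >= 2 -> ~ box (x, y).
Proof.
rewrite /box/= !in_itv/= -!ler_norml => h [hx hy].
by case: h => h; [have := le_trans h hx | have := le_trans h hy]; lra.
Qed.

(** Fubini, integrating first along the direction of differentiation, where every line integral is
    0. *)
Lemma int_deriv0 e F G : e = e1 \/ e = e2 -> continuous G ->
  (forall z, is_derive z e F (G z)) ->
  (forall z, ~ box z -> F z = 0) -> (forall z, ~ box z -> G z = 0) ->
  \int[mu]_z G z = 0.
Proof.
move=> he cG FG F0 G0; rewrite /Rintegral.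
have iG := integrable_box cG G0.
case: he => he; subst e.
- rewrite -(integral21_prod_meas1 iG) /fubini_G /= integral0_eq// => y _.
  apply: (@line_integral0 (fun t => F (t, y))).
  + move=> t; apply: (@continuous_comp _ _ _ (fun t => (t, y)) G); last exact: cG.
    by apply: (@cvg_pair _ _ _ (nbhs t) (nbhs t) (nbhs y)); [exact: cvg_id | exact: cvg_cst].
  + by move=> t; apply: isder_row; exact: FG.
  + by move=> t ht; apply: F0; apply: box_ge2; left.
  + by move=> t ht; apply: G0; apply: box_ge2; left.
- rewrite -(integral12_prod_meas1 iG) /fubini_F /= integral0_eq// => x _.
  apply: (@line_integral0 (fun t => F (x, t))).
  + move=> t; apply: (@continuous_comp _ _ _ (fun t => (x, t)) G); last exact: cG.
    by apply: (@cvg_pair _ _ _ (nbhs t) (nbhs x) (nbhs t)); [exact: cvg_cst | exact: cvg_id].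
  + by move=> t; apply: isder_col; exact: FG.
  + by move=> t ht; apply: F0; apply: box_ge2; right.
  + by move=> t ht; apply: G0; apply: box_ge2; right.
Qed.

Lemma near_disk z : D z -> \forall y \near z, D y.
Proof. by move=> Dz; apply: open_nbhs_nbhs; split => //; exact: open_disk. Qed.

Lemma near_compactC (K : set (R * R)) z : compact K -> ~ K z -> \forall y \near z, ~ K y.
Proof.
move=> cK Kz; apply: open_nbhs_nbhs; split => //; apply: closed_openC.
by apply: compact_closed => //; exact: norm_hausdorff.
Qed.

(** The disk and the complement of [K] are two open sets covering the plane, and on the second one
    the function is zero. *)
Lemma continuous_restrict_disk (K : set (R * R)) g (th : R * R -> R) : compact K -> K `<=` D ->
  (forall z, D z -> {for z, continuous g}) -> continuous th ->
  (forall z, ~ K z -> th z = 0) -> continuous ((fun z => g z * th z) \_ D).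
Proof.
move=> cK KD cg cth th0 z; rewrite /continuous_at.
have [Dz|nDz] := pselect (D z).
- rewrite patchE mem_set//.
  apply: (@cvg_trans _ ((fun z => g z * th z) @ z)).
    apply: near_eq_cvg; apply: filterS (near_disk Dz) => y Dy.
    by rewrite patchE mem_set.
  exact: (@cvgM _ _ _ _ g th _ _ (cg z Dz) (cth z)).
- have nKz : ~ K z by move=> /KD.
  apply: cvg_near_cst; apply: filterS (near_compactC cK nKz) => y Ky.
  by rewrite !patchE th0// mulr0 if_same memNset.
Qed.

(** The derivative of [f * eta], extended by zero, is continuous with compact support, so its
    integral is 0. Regularity is asked only inside the disk: [f] and [df] may blow up at the
    circle. *)
Lemma weak_derivative_classical e f df : e = e1 \/ e = e2 ->
  (forall z, D z -> {for z, continuous f}) ->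
  (forall z, D z -> {for z, continuous df}) ->
  (forall z, D z -> is_derive z e f (df z)) ->
  weak_derivative e f df.
Proof.
move=> he cf cdf fdf eta [sm [K [cK KD eta0]]].
have ceta : continuous eta by exact: (sm 0%N).
have [deta cDeta] : (forall x, derivable eta x e) /\ continuous ('D_e eta).
  by have := sm 1%N; apply.
have e0 : e != 0.
  by case: he => ->; rewrite /e1 /e2; apply/eqP => -[] /eqP; rewrite oner_eq0.
have Deta0 z : ~ K z -> 'D_e eta z = 0.
  move=> nKz; have d0 : is_derive z e (fun=> 0 : R) 0 by exact: isder_cst.
  have : is_derive z e eta 0.
    apply: (isder_near e0 _ d0); apply: filterS (near_compactC cK nKz) => y Ky.
    by rewrite eta0.
  by case.
have cA := continuous_restrict_disk cK KD cf cDeta Deta0.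
have cB := continuous_restrict_disk cK KD cdf ceta eta0.
have off h z : ~ box z -> (h \_ D) z = 0 :> R.
  by move=> bz; rewrite patchE memNset// => /disk_box.
have iA := integrable_box cA (off _); have iB := integrable_box cB (off _).
apply/eqP; rewrite -subr_eq0 opprK.
rewrite [X in X + _]Rintegral_mkcond [X in _ + X]Rintegral_mkcond -RintegralD//.
apply/eqP.
apply: (@int_deriv0 e ((fun z => f z * eta z) \_ D)) => //.
- by move=> z; exact: (@cvgD _ _ _ _ _ _ _ _ _ (cA z) (cB z)).
- move=> z; have [Dz|nDz] := pselect (D z).
    rewrite !patchE mem_set//.
    have dM := isderM (fdf z Dz) (derivableP (deta z)).
    rewrite [X in _ + X]mulrC.
    apply: (isder_near e0 _ dM); apply: filterS (near_disk Dz) => y Dy.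
    by rewrite patchE mem_set.
  have nKz : ~ K z by move=> /KD.
  rewrite !patchE memNset// addr0.
  have d0 : is_derive z e (fun=> 0 : R) 0 by exact: isder_cst.
  apply: (isder_near e0 _ d0); apply: filterS (near_compactC cK nKz) => y Ky.
  by rewrite patchE eta0// mulr0 if_same.
- by move=> z; exact: off.
- by move=> z bz; rewrite !off// addr0.
Qed.

End CompactSupport.

(** * Green's formula up to the boundary, by cutoff *)

Section Green.
Context {R : realType}.
Notation T2 := (measurableTypeR R * measurableTypeR R)%type.
Notation mu := (@lebesgue2 R).
Notation D := (@disk R : set T2).
Implicit Types (f g h u w : R * R -> R) (z : R * R).

Lemma continuous_bounded_disk w : continuous w ->
  exists C : R, forall z, D z -> `|w z| <= C.
Proof.
by move=> /continuous_bounded_box[C wC]; exists C => z /disk_box; exact: wC.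
Qed.

Lemma continuous_measurable_disk w : continuous w -> measurable_fun D w.
Proof. by move=> cw; apply: measurable_funTS; exact: continuous_measurable2. Qed.

Lemma integ_continuous f w : integ f -> continuous w -> integ (fun z => f z * w z).
Proof.
move=> fi cw; have [C wC] := continuous_bounded_disk cw.
by apply: (integM fi _ wC); exact: continuous_measurable_disk.
Qed.

Lemma continuous_cutoff n k w : pol w ->
  continuous (fun z => flat k (cutarg n z) * w z).
Proof.
by move=> pw; apply: (smooth_flatpol (pol_cutarg n) (flatpol_term _ k pw) 0%N).
Qed.

Lemma cvg_Rint_cutoff f w : integ f -> pol w ->
  \int[mu]_(z in D) (f z * (flat 0 (cutarg n z) * w z)) @[n --> \oo] -->
  \int[mu]_(z in D) (f z * w z).
Proof.
move=> fi pw; have [C wC] := continuous_bounded_disk (continuous_pol pw).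
apply: (@cvg_Rint _ _ (fun n z => flat 0 (cutarg n z) * w z) _ C) => //.
- by move=> n; apply: continuous_measurable_disk; exact: continuous_cutoff.
- by apply: continuous_measurable_disk; exact: continuous_pol.
- move=> n z Dz; rewrite normrM ger0_norm ?flat_ge0// -[leRHS]mul1r.
  by apply: ler_pM => //; [exact: flat_ge0 | exact: flat_bounded | exact: wC].
- move=> z Dz; rewrite -[X in _ --> X]mul1r; apply: cvgMl.
  by apply: flat_cvg1; exact: cvg_cutarg.
Qed.

(** Both sides agree for the cut-off [w], and the cutoff is then removed. This lets one replace the
    weak gradient of [b] that comes with an arbitrary solution by the classical one. *)
Lemma weak_derivative_unique e u g1 g2 w : weak_derivative e u g1 ->
  weak_derivative e u g2 -> integ g1 -> integ g2 -> pol w ->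
  \int[mu]_(z in D) (g1 z * w z) = \int[mu]_(z in D) (g2 z * w z).
Proof.
move=> ug1 ug2 i1 i2 pw.
apply: (cvg_unique _ (cvg_Rint_cutoff i1 pw)) => //.
rewrite (_ : (fun n => _) = fun n =>
  \int[mu]_(z in D) (g2 z * (flat 0 (cutarg n z) * w z))).
  exact: cvg_Rint_cutoff.
apply/funext => n; apply: oppr_inj.
by rewrite -ug1 -?ug2//; exact: test_function_cutoff.
Qed.

(* Tangency of (w1, w2) to the unit circle keeps bounded the term where the
   derivative falls on the cutoff, although that derivative blows up. *)
Lemma weak_divergence f g1 g2 w1 w2 h :
  integ f -> integ g1 -> integ g2 ->
  weak_derivative e1 f g1 -> weak_derivative e2 f g2 ->
  pol w1 -> pol w2 -> pol h ->
  (forall z, w1 z * z.1 + w2 z * z.2 = - (rim z * h z)) ->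
  \int[mu]_(z in D) (g1 z * w1 z) + \int[mu]_(z in D) (g2 z * w2 z) =
  - \int[mu]_(z in D) (f z * ('D_e1 w1 z + 'D_e2 w2 z)).
Proof.
move=> fi i1 i2 fg1 fg2 p1 p2 ph hW.
pose k n z := flat 0 (cutarg n z) * ('D_e1 w1 z + 'D_e2 w2 z) +
  (flat 1 (cutarg n z) * (2 * h z) + flat 2 (cutarg n z) * (2 * h z)).
have pdiv : pol (fun z => 'D_e1 w1 z + 'D_e2 w2 z) by apply: polD; exact: polDer.
have p2h : pol (fun z => 2 * h z) by apply: polM => //; exact: pol_cst.
(* Tangency turns the blowing-up factor into 2 (n + 1) [rim z * h z], that is 2 ([cutarg n z] + 1)
   [h z], and [flatS] absorbs [cutarg n z] by lowering index 2 to index 1. *)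
have kE n z : 'D_e1 (fun z => flat 0 (cutarg n z) * w1 z) z +
    'D_e2 (fun z => flat 0 (cutarg n z) * w2 z) z = k n z.
  rewrite !derive_cutoff// !derive_cutarg !derive_rim /k.
  rewrite -(flatS 1); set F := flat 0 _; set G := flat 2 _.
  transitivity (F * ('D_e1 w1 z + 'D_e2 w2 z) +
    G * (- 2 * n.+1%:R) * (w1 z * z.1 + w2 z * z.2)).
    by rewrite /e1 /e2 /=; ring.
  by rewrite hW /cutarg; ring.
have ck n : continuous (k n).
  move=> z; apply: cvgD; first exact: continuous_cutoff.
  by apply: cvgD; exact: continuous_cutoff.
have [C1 divC] := continuous_bounded_disk (continuous_pol pdiv).
have [C2 hC] := continuous_bounded_disk (continuous_pol p2h).
have lim_k : \int[mu]_(z in D) (f z * k n z) @[n --> \oo] -->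
    \int[mu]_(z in D) (f z * ('D_e1 w1 z + 'D_e2 w2 z)).
  apply: (@cvg_Rint _ _ k _ (C1 + (C2 + 2 * C2))) => //.
  - by move=> n; exact: continuous_measurable_disk.
  - by apply: continuous_measurable_disk; exact: continuous_pol.
  - have b m n z x C : `|x| <= C -> `|flat m (cutarg n z) * x| <= m`!%:R * C.
      move=> xC; rewrite normrM ger0_norm ?flat_ge0//.
      by apply: ler_pM => //; [exact: flat_ge0 | exact: flat_bounded].
    move=> n z Dz; rewrite /k.
    apply: le_trans (ler_normD _ _) _; apply: lerD.
      by rewrite -[C1]mul1r; exact: (b 0 n z _ _ (divC z Dz)).
    apply: le_trans (ler_normD _ _) _; apply: lerD.
      by rewrite -[C2]mul1r; exact: (b 1 n z _ _ (hC z Dz)).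
    exact: (b 2 n z _ _ (hC z Dz)).
  (* In the open disk the cutoff tends to 1 and the terms carrying its gradient tend to 0, so no
     boundary term survives. *)
  - move=> z Dz; rewrite /k.
    have cc := cvg_cutarg Dz.
    rewrite [X in _ --> X](_ : _ = 1 * ('D_e1 w1 z + 'D_e2 w2 z) +
      (0 * (2 * h z) + 0 * (2 * h z))); last by rewrite mul1r !mul0r !addr0.
    apply: cvgD; first by apply: cvgMl; exact: flat_cvg1.
    by apply: cvgD; apply: cvgMl; exact: flat_cvg0.
set G := (X in X = _).
have lim_g : \int[mu]_(z in D) (g1 z * (flat 0 (cutarg n z) * w1 z)) +
    \int[mu]_(z in D) (g2 z * (flat 0 (cutarg n z) * w2 z)) @[n --> \oo] --> G.
  by apply: cvgD; exact: cvg_Rint_cutoff.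
apply: (cvg_unique _ lim_g) => //.
rewrite [X in X @ _](_ : _ = (fun n => - \int[mu]_(z in D) (f z * k n z))).
  exact: cvgN.
apply/funext => n.
have t1 := test_function_cutoff n p1; have t2 := test_function_cutoff n p2.
have cD1 : continuous ('D_e1 (fun z => flat 0 (cutarg n z) * w1 z)).
  by case: t1 => /(_ 1%N)/(_ e1 (or_introl erefl))[].
have cD2 : continuous ('D_e2 (fun z => flat 0 (cutarg n z) * w2 z)).
  by case: t2 => /(_ 1%N)/(_ e2 (or_intror erefl))[].
rewrite -[LHS]opprK opprD -fg1// -fg2// -RintegralD//.
- by congr (- _); apply: eq_Rintegral => z _; rewrite -mulrDr kE.
- exact: measurable_disk.
- exact: integ_continuous.
- exact: integ_continuous.
Qed.

End Green.

Definition pd {R : realType} (e : R * R) (f : R * R -> R) z : R := 'D_e f z.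

(* Unfolding derivatives in order to compare the atoms of [ring] is costly. *)
Ltac ring_pd := repeat match goal with
  | |- context [@pd ?R ?e ?f ?z] => generalize (@pd R e f z); intro end; ring.

(** * Polynomial test functions with vanishing normal derivative *)

Section Harmonics.
Context {R : realType}.
Implicit Types (f g h v w H : R * R -> R) (e z : R * R) (n m k : nat).

Lemma pol_pd e f : pol f -> pol (pd e f).
Proof. exact: polDer. Qed.

Lemma DpolD f g e : pol f -> pol g ->
  pd e (fun z => f z + g z) = fun z => pd e f z + pd e g z.
Proof.
move=> pf pg; apply/funext => z; rewrite /pd.
by have [_ ->] := isderD (pol_isder e z pf) (pol_isder e z pg).
Qed.

Lemma DpolM f g e : pol f -> pol g ->
  pd e (fun z => f z * g z) = fun z => f z * pd e g z + g z * pd e f z.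
Proof.
move=> pf pg; apply/funext => z; rewrite /pd.
by have [_ ->] := isderM (pol_isder e z pf) (pol_isder e z pg).
Qed.

Lemma DpolX f n e : pol f ->
  pd e (fun z => f z ^+ n) = fun z => n%:R * f z ^+ n.-1 * pd e f z.
Proof.
by move=> pf; apply/funext => z; rewrite /pd; have [_ ->] := isderX n (pol_isder e z pf).
Qed.

Lemma DpolZ c f e : pol f -> pd e (fun z => c * f z) = fun z => c * pd e f z.
Proof.
move=> pf; rewrite (DpolM e (pol_cst c) pf).
by apply/funext => z; rewrite /pd; rewrite /pd; have [_ ->] := isder_cst c z e; rewrite mulr0 addr0.
Qed.

Lemma Dpol_fst e : pd e (fun z => z.1) = fun=> e.1.
Proof. by apply/funext => z; rewrite /pd; have [_ ->] := isder_fst z e. Qed.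

Lemma Dpol_snd e : pd e (fun z => z.2) = fun=> e.2.
Proof. by apply/funext => z; rewrite /pd; have [_ ->] := isder_snd z e. Qed.

Lemma Dpol_cst c e : pd e (fun=> c) = fun=> 0.
Proof. by apply/funext => z; rewrite /pd; have [_ ->] := isder_cst c z e. Qed.

(** The Euler operator, whose eigenvalue on a homogeneous polynomial is its degree. *)
Definition euler v z := z.1 * pd e1 v z + z.2 * pd e2 v z.

Definition lap v z := pd e1 (pd e1 v) z + pd e2 (pd e2 v) z.

Lemma eulerD v w z : pol v -> pol w ->
  euler (fun z => v z + w z) z = euler v z + euler w z.
Proof. by move=> pv pw; rewrite /euler (DpolD e1 pv pw) (DpolD e2 pv pw) /=; ring_pd. Qed.

Lemma eulerZ c v z : pol v -> euler (fun z => c * v z) z = c * euler v z.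
Proof. by move=> pv; rewrite /euler (DpolZ c e1 pv) (DpolZ c e2 pv) /=; ring_pd. Qed.

Lemma lapD v w z : pol v -> pol w -> lap (fun z => v z + w z) z = lap v z + lap w z.
Proof.
move=> pv pw; have qv e := pol_pd e pv; have qw e := pol_pd e pw.
by rewrite /lap !(DpolD _ pv pw) (DpolD e1 (qv e1) (qw e1)) (DpolD e2 (qv e2) (qw e2)) /=; ring_pd.
Qed.

Lemma lapZ c v z : pol v -> lap (fun z => c * v z) z = c * lap v z.
Proof.
move=> pv; have qv e := pol_pd e pv.
by rewrite /lap !(DpolZ _ _ pv) (DpolZ _ e1 (qv e1)) (DpolZ _ e2 (qv e2)) /=; ring_pd.
Qed.

Definition sq z : R := z.1 ^+ 2 + z.2 ^+ 2.

Lemma pol_sq : pol sq.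
Proof. by apply: polD; apply: polX; [exact: pol_fst | exact: pol_snd]. Qed.

Lemma Dpol_sq e : pd e sq = fun z => 2 * z.1 * e.1 + 2 * z.2 * e.2.
Proof.
have pf := @pol_fst R; have pg := @pol_snd R.
rewrite -[sq]/(fun z => z.1 ^+ 2 + z.2 ^+ 2) (DpolD _ (polX 2 pf) (polX 2 pg)).
by rewrite (DpolX _ _ pf) (DpolX _ _ pg) Dpol_fst Dpol_snd.
Qed.

Lemma euler_sqX k H z (m : R) : pol H -> euler H z = m * H z ->
  euler (fun z => sq z ^+ k * H z) z = (k.*2%:R + m) * (sq z ^+ k * H z).
Proof.
move=> pH; have ps := polX k pol_sq.
rewrite /euler !(DpolM _ ps pH) !(DpolX k _ pol_sq) !Dpol_sq /e1 /e2 /= => E.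
transitivity (k.*2%:R * (sq z ^+ k * H z) + sq z ^+ k * (m * H z)); last by ring_pd.
rewrite -E -mul2n natrM.
case: k {ps} => [|k] /=; first by rewrite !expr0; ring_pd.
by rewrite exprS; set S := sq z ^+ k; rewrite /sq; ring_pd.
Qed.

(** The Laplacian of r^(2k+2) is 4 (k+1)^2 r^(2k); the cross term, twice the product of the
    gradients, is 4 (k+1) r^(2k) times the Euler derivative of [H], hence the summand [m]. *)
Lemma lap_sqX k H (m : R) z : pol H -> (forall z, euler H z = m * H z) ->
  (forall z, lap H z = 0) ->
  lap (fun z => sq z ^+ k.+1 * H z) z =
    4 * k.+1%:R * (k.+1%:R + m) * (sq z ^+ k * H z).
Proof.
move=> pH E L.
have p1 := pol_pd e1 pH; have p2 := pol_pd e2 pH.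
have ps n := polX n pol_sq; have pf := @pol_fst R; have pg := @pol_snd R.
have D e : pd e (fun z => sq z ^+ k.+1 * H z) =
  fun z => sq z ^+ k.+1 * pd e H z +
    (2 * k.+1%:R) * (sq z ^+ k * (H z * (z.1 * e.1 + z.2 * e.2))).
  rewrite (DpolM _ (ps k.+1) pH) (DpolX k.+1 _ pol_sq) Dpol_sq.
  by apply/funext => y /=; ring_pd.
have pc c := pol_cst (R := R) c.
have pl (e : R * R) : pol (fun z => z.1 * e.1 + z.2 * e.2) by apply: polD; exact: polM.
have Dl e' (e : R * R) : pd e' (fun z => z.1 * e.1 + z.2 * e.2) =
    fun=> e'.1 * e.1 + e'.2 * e.2.
  rewrite (DpolD _ (polM pf (pc e.1)) (polM pg (pc e.2))).
  rewrite (DpolM _ pf (pc e.1)) (DpolM _ pg (pc e.2)) Dpol_fst Dpol_snd !Dpol_cst.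
  by apply/funext => y /=; ring_pd.
have pHl e := polM pH (pl e).
have DD e : pd e (fun z => sq z ^+ k.+1 * pd e H z +
    (2 * k.+1%:R) * (sq z ^+ k * (H z * (z.1 * e.1 + z.2 * e.2)))) z =
  sq z ^+ k.+1 * pd e (pd e H) z +
   (2 * k.+1%:R) * (2 * sq z ^+ k * (pd e H z * (z.1 * e.1 + z.2 * e.2))
      + sq z ^+ k * (H z * (e.1 * e.1 + e.2 * e.2))
      + 2 * k%:R * sq z ^+ k.-1 * (H z * (z.1 * e.1 + z.2 * e.2) ^+ 2)).
  have q := pol_pd e pH.
  rewrite (DpolD _ (polM (ps k.+1) q) (polM (pc _) (polM (ps k) (pHl e)))).
  rewrite (DpolM _ (ps k.+1) q) (DpolZ _ _ (polM (ps k) (pHl e))).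
  rewrite (DpolM _ (ps k) (pHl e)) (DpolM _ pH (pl e)) Dl.
  rewrite !(DpolX _ _ pol_sq) Dpol_sq /=; ring_pd.
rewrite /lap !D !DD; have := L z; rewrite /lap => L0.
transitivity (sq z ^+ k.+1 * (pd e1 (pd e1 H) z + pd e2 (pd e2 H) z) +
   (2 * k.+1%:R) * (2 * sq z ^+ k * euler H z + 2 * (sq z ^+ k * H z)
     + 2 * (k%:R * sq z ^+ k.-1 * sq z) * H z)).
  by rewrite /euler /e1 /e2 /= [in RHS]/sq; ring_pd.
rewrite L0 mulr0 add0r E.
(* For [k] = 0 the truncated predecessor is harmless, the coefficient being 0. *)
have -> : k%:R * sq z ^+ k.-1 * sq z = k%:R * sq z ^+ k.
  by case: (k) => [|j]; [rewrite !mul0r | rewrite /= exprSr mulrA].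
by rewrite -[k.+1]addn1 natrD; ring_pd.
Qed.

(** Real and imaginary parts of (x + i y)^m. *)
Fixpoint zpow m : (R * R -> R) * (R * R -> R) :=
  if m is m'.+1 then
    ((fun z => z.1 * (zpow m').1 z - z.2 * (zpow m').2 z),
     (fun z => z.1 * (zpow m').2 z + z.2 * (zpow m').1 z))
  else ((fun=> 1), (fun=> 0)).

Notation rez m := (zpow m).1.
Notation imz m := (zpow m).2.

Lemma pol_zpow m : pol (rez m) /\ pol (imz m).
Proof.
have pf := @pol_fst R; have pg := @pol_snd R.
elim: m => [|m [pr pi]] /=; first by split; exact: pol_cst.
by split; [apply: polB; exact: polM | apply: polD; exact: polM].
Qed.

(** The derivative of z^(m+1) is (m+1) z^m, read through the Cauchy-Riemann equations. *)
Lemma Dpol_zpow m z :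
  [/\ pd e1 (rez m.+1) z = m.+1%:R * rez m z, pd e2 (rez m.+1) z = - (m.+1%:R * imz m z),
      pd e1 (imz m.+1) z = m.+1%:R * imz m z & pd e2 (imz m.+1) z = m.+1%:R * rez m z].
Proof.
have pf := @pol_fst R; have pg := @pol_snd R.
have H n e : pd e (rez n.+1) z = z.1 * pd e (rez n) z + rez n z * e.1
    - (z.2 * pd e (imz n) z + imz n z * e.2) /\
    pd e (imz n.+1) z = z.1 * pd e (imz n) z + imz n z * e.1
    + (z.2 * pd e (rez n) z + rez n z * e.2).
  have [pr pi] := pol_zpow n; split => /=.
  - have -> : (fun z => z.1 * rez n z - z.2 * imz n z) =
        fun z => z.1 * rez n z + -1 * (z.2 * imz n z).
      by apply/funext => y; rewrite mulN1r.
    rewrite (DpolD _ (polM pf pr) (polM (pol_cst (-1)) (polM pg pi))).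
    rewrite (DpolZ _ _ (polM pg pi)) (DpolM _ pf pr) (DpolM _ pg pi).
    by rewrite Dpol_fst Dpol_snd /=; ring_pd.
  - rewrite (DpolD _ (polM pf pi) (polM pg pr)) (DpolM _ pf pi) (DpolM _ pg pr).
    by rewrite Dpol_fst Dpol_snd /=; ring_pd.
elim: m => [|m [I1 I2 I3 I4]].
  by split; have [h1 h2] := H 0%N e1; have [h3 h4] := H 0%N e2;
    rewrite ?h1 ?h2 ?h3 ?h4 /= !Dpol_cst /e1 /e2 /=; ring_pd.
have [h1 h2] := H m.+1 e1; have [h3 h4] := H m.+1 e2.
rewrite h1 h2 h3 h4 I1 I2 I3 I4 /e1 /e2 -[m.+2]addn1 natrD.
by split => /=; ring_pd.
Qed.

Lemma euler_rez m z : euler (rez m) z = m%:R * rez m z.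
Proof.
case: m => [|m]; first by rewrite /euler /= !Dpol_cst; ring_pd.
by rewrite /euler; have [-> -> _ _] := Dpol_zpow m z; rewrite /=; ring_pd.
Qed.

Lemma lap_rez m z : lap (rez m) z = 0.
Proof.
case: m => [|m]; first by rewrite /lap /= !Dpol_cst; ring_pd.
have [pr pi] := pol_zpow m.
have -> : lap (rez m.+1) z = m.+1%:R * (pd e1 (rez m) z - pd e2 (imz m) z).
  rewrite /lap (_ : pd e1 (rez m.+1) = fun z => m.+1%:R * rez m z); last first.
    by apply/funext => y; have [] := Dpol_zpow m y.
  rewrite (_ : pd e2 (rez m.+1) = fun z => - m.+1%:R * imz m z); last first.
    by apply/funext => y; have [_ ->] := Dpol_zpow m y; rewrite mulNr.
  by rewrite (DpolZ _ _ pr) (DpolZ _ _ pi) /=; ring_pd.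
case: m pr pi => [|m] _ _; first by rewrite /= !Dpol_cst; ring_pd.
by have [-> _ _ ->] := Dpol_zpow m z; ring_pd.
Qed.

(* The class of functions for which the Neumann problem with constant boundary
   datum has a polynomial solution [v]: on the unit circle [rim] vanishes and
   [euler v] is the normal derivative. *)
Definition solvable f := exists v h c, [/\ pol v, pol h,
  forall z, euler v z = c - rim z * h z & forall z, lap v z = f z].

Lemma solvableD f g : solvable f -> solvable g -> solvable (fun z => f z + g z).
Proof.
move=> [v [h [c [pv ph E L]]]] [v' [h' [c' [pv' ph' E' L']]]].
exists (fun z => v z + v' z), (fun z => h z + h' z), (c + c').
split; [exact: polD | exact: polD | move=> z | move=> z].
- by rewrite eulerD// E E'; ring_pd.
- by rewrite lapD// L L'.
Qed.

Lemma solvableZ a f : solvable f -> solvable (fun z => a * f z).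
Proof.
move=> [v [h [c [pv ph E L]]]].
exists (fun z => a * v z), (fun z => a * h z), (a * c).
have pa := pol_cst (R := R) a.
split; [exact: polM | exact: polM | move=> z | move=> z].
- by rewrite eulerZ// E; ring_pd.
- by rewrite lapZ// L.
Qed.

(** 1 - s divides 1 - s^k; the equality r^(2k) = 1 on the circle thus becomes a polynomial identity
    in the plane. *)
Lemma sqX_rim k : exists2 g, pol g & forall z, sq z ^+ k = 1 - rim z * g z.
Proof.
elim: k => [|k [g pg IH]].
  by exists (fun=> 0); [exact: pol_cst | move=> z; rewrite mulr0 subr0 expr0].
exists (fun z => 1 + sq z * g z).
  by apply: polD; [exact: pol_cst | apply: polM => //; exact: pol_sq].
by move=> z; rewrite exprS IH /rim -/(sq z); ring_pd.
Qed.

(** Up to the factor [a], the function is the Laplacian of r^(2k+2) Re z^m, whose normal derivative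
    on the circle is [d m] Re z^m. For [m] = 0 this is a constant, as wanted; otherwise it is
    cancelled by subtracting ([d m] / m) Re z^m, which is harmonic. *)
Lemma solvable_sqX_rez k m : solvable (fun z => sq z ^+ k * rez m z).
Proof.
have [pr _] := pol_zpow m; have [g pg gE] := sqX_rim k.+1.
have ps := polX k.+1 pol_sq.
pose a : R := 4 * k.+1%:R * (k.+1%:R + m%:R).
have a0 : a != 0 by rewrite !mulf_neq0// -?natrD ?pnatr_eq0.
have pv : pol (fun z => sq z ^+ k.+1 * rez m z) by exact: polM.
suff [w [h [c [pw ph E L]]]] : solvable (fun z => a * (sq z ^+ k * rez m z)).
  exists (fun z => a^-1 * w z), (fun z => a^-1 * h z), (a^-1 * c).
  have pa := pol_cst (R := R) a^-1.
  split; [exact: polM | exact: polM | move=> z | move=> z].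
  - by rewrite eulerZ// E; ring_pd.
  - by rewrite lapZ// L mulKf.
have L z := lap_sqX k z pr (euler_rez m) (lap_rez m).
have E z := euler_sqX k.+1 pr (euler_rez m z).
clear a0; rewrite /a; clear a; pose d (j : nat) : R := k.+1.*2%:R + j%:R.
case: m pr pv L E => [|m] pr pv L E.
- exists (fun z => sq z ^+ k.+1 * rez 0 z), (fun z => d 0%N * g z), (d 0%N).
  split=> // [|z]; first by apply: polM => //; exact: pol_cst.
  by rewrite E gE /=; rewrite /d; ring_pd.
- exists (fun z => sq z ^+ k.+1 * rez m.+1 z + (- (d m.+1 / m.+1%:R)) * rez m.+1 z),
    (fun z => d m.+1 * (g z * rez m.+1 z)), 0.
  have pc c := pol_cst (R := R) c.
  split=> [||z|z].
  + by apply: polD => //; exact: polM.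
  + by apply: polM => //; exact: polM.
  + rewrite eulerD ?eulerZ//; last exact: polM.
    rewrite E euler_rez gE -/(d m.+1).
    have m0 : m.+1%:R != 0 :> R by rewrite pnatr_eq0.
    by set r := rez _ _; field.
  + by rewrite lapD ?lapZ//; [rewrite L lap_rez; ring_pd | exact: polM].
Qed.

(** Real parts suffice because the powers of 1 + x are even in y. *)
Inductive hspan : (R * R -> R) -> Prop :=
| hspan_term c k m : hspan (fun z => c * (sq z ^+ k * rez m z))
| hspanD f g : hspan f -> hspan g -> hspan (fun z => f z + g z).

Lemma solvable_hspan f : hspan f -> solvable f.
Proof.
elim=> [c k m|g h _ sg _ sh]; last exact: solvableD.
by apply: solvableZ; exact: solvable_sqX_rez.
Qed.

(** From 2x = z + conj z one gets 2x Re z^(m+1) = Re z^(m+2) + r^2 Re z^m. *)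
Lemma hspan_fstM f : hspan f -> hspan (fun z => z.1 * f z).
Proof.
elim=> {f} [c k [|m]|f g _ hf _ hg].
- rewrite (_ : (fun _ => _) = fun z => c * (sq z ^+ k * rez 1 z)).
    exact: hspan_term.
  by apply/funext => z /=; ring_pd.
- rewrite (_ : (fun _ => _) = fun z => c / 2 * (sq z ^+ k * rez m.+2 z) +
    c / 2 * (sq z ^+ k.+1 * rez m z)).
    by apply: hspanD; exact: hspan_term.
  by apply/funext => z /=; rewrite exprS; set S := sq z ^+ k; rewrite /sq; field.
- rewrite (_ : (fun _ => _) = fun z => z.1 * f z + z.1 * g z); first exact: hspanD.
  by apply/funext => z; ring_pd.
Qed.

Lemma hspan_expr n : hspan (fun z => (1 + z.1) ^+ n).
Proof.
elim: n => [|n IH].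
  rewrite (_ : (fun _ => _) = fun z => 1 * (sq z ^+ 0 * rez 0 z)).
    exact: hspan_term.
  by apply/funext => z /=; rewrite !expr0; ring_pd.
rewrite (_ : (fun _ => _) = fun z => (1 + z.1) ^+ n + z.1 * (1 + z.1) ^+ n).
  by apply: hspanD => //; exact: hspan_fstM.
by apply/funext => z; rewrite exprS; ring_pd.
Qed.

(** The constant normal derivative [c] is removed by subtracting (c/2) r^2. This shifts the
    Laplacian by the constant [d] = 2c, invisible to functions of mean zero. *)
Lemma neumann_polynomial n : exists v h d, [/\ pol v, pol h,
  forall z, euler v z = - (rim z * h z) & forall z, lap v z = (1 + z.1) ^+ n - d].
Proof.
have [v [h [c [pv ph E L]]]] := solvable_hspan (hspan_expr n).
have pc a := pol_cst (R := R) a; have ps := pol_sq.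
exists (fun z => v z + (- (c / 2)) * sq z), (fun z => h z - c), (2 * c).
split=> [||z|z].
- by apply: polD => //; exact: polM.
- exact: polB.
- rewrite (eulerD _ pv (polM (pc _) ps)) (eulerZ _ _ ps) E.
  by rewrite /euler !Dpol_sq /e1 /e2 /= /rim; field.
- rewrite (lapD _ pv (polM (pc _) ps)) (lapZ _ _ ps) L.
  have -> : lap sq z = 4.
    have Q a b e : pd e (fun z => 2 * z.1 * a + 2 * z.2 * b) =
        fun=> 2 * a * e.1 + 2 * b * e.2.
      have -> : (fun z : R * R => 2 * z.1 * a + 2 * z.2 * b) =
          fun z => (2 * a) * z.1 + (2 * b) * z.2.
        by apply/funext => y; ring_pd.
      rewrite (DpolD _ (polM (pc _) (@pol_fst R)) (polM (pc _) (@pol_snd R))).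
      by rewrite (DpolZ _ _ (@pol_fst R)) (DpolZ _ _ (@pol_snd R)) Dpol_fst Dpol_snd.
    by rewrite /lap !Dpol_sq !Q /e1 /e2 /=; ring_pd.
  by field.
Qed.

End Harmonics.

(** * Finiteness of the Dirichlet integral *)

Section DirichletIntegral.
Context {R : realType}.
Notation T1 := (measurableTypeR R).
Notation T2 := (measurableTypeR R * measurableTypeR R)%type.
Notation mu := (@lebesgue2 R).
Notation leb := (@lebesgue_measure R).
Notation D := (@disk R : set T2).
Implicit Types (z : R * R) (x y u : R).

(* [lg] and [ag] below are the real and imaginary parts of [3 - log (1 - z)], whose
   squared modulus is [md]; [qd z] is [|1 - z|^2]. *)
Definition qd z : R := (1 - z.1) ^+ 2 + z.2 ^+ 2.

Definition lg z : R := 3 - ln (qd z) / 2.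

(** In the disk |1 - z|^2 < 2 (1 - x), so this is a lower bound for [lg] depending on the abscissa
    alone; it lets the integral in y be computed with the logarithm frozen. *)
Definition la x : R := 3 - ln (2 * (1 - x)) / 2.

(** The argument of the logarithm is at most 4, and log y < y makes half of the logarithm less than
    2. *)
Lemma la_ge1 x : -1 <= x < 1 -> 1 <= la x.
Proof.
move=> /andP[h1 h2]; have h : 0 < 2 * (1 - x) by lra.
by have := ln_sublinear h; rewrite /la; lra.
Qed.

Lemma disk_fst z : D z -> -1 < z.1 < 1.
Proof. by rewrite /disk/= => ?; apply/andP; split; nra. Qed.

Lemma disk_snd z : D z -> -1 < z.2 < 1.
Proof. by rewrite /disk/= => ?; apply/andP; split; nra. Qed.

Lemma qd_gt0 z : z.1 < 1 -> 0 < qd z.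
Proof. by rewrite /qd => ?; nra. Qed.

Lemma la_le_lg z : D z -> la z.1 <= lg z.
Proof.
move=> Dz; have /andP[x1 x2] := disk_fst Dz; have q0 := qd_gt0 x2.
rewrite /la /lg lerD2l lerN2 ler_pM2r// ler_ln ?posrE//; last lra.
by move: Dz; rewrite /disk /qd /= => ?; nra.
Qed.

Lemma lg_ge1 z : D z -> 1 <= lg z.
Proof.
move=> Dz; apply: le_trans (la_le_lg Dz); apply: la_ge1.
by have /andP[x1 x2] := disk_fst Dz; rewrite ltW.
Qed.

(** Majorant of the squared gradient 1 / (|1 - z|^2 |L|^2), with |L| replaced by its real part. *)
Definition dirichlet z : R := (qd z * lg z ^+ 2)^-1.

Lemma isder_qd z (v : R * R) :
  is_derive z v qd (- 2 * (1 - z.1) * v.1 + 2 * z.2 * v.2).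
Proof.
have d1 := isderX 2 (isderD (isder_cst 1 z v) (isderN (isder_fst z v))).
have d2 := isderX 2 (isder_snd z v).
by apply: (is_derive_eq (isderD d1 d2)) => /=; ring.
Qed.

Lemma pol_qd : pol qd.
Proof.
apply: polD; apply: polX; last exact: pol_snd.
by apply: polB; [exact: pol_cst | exact: pol_fst].
Qed.

Lemma continuous_lg z : D z -> {for z, continuous lg}.
Proof.
move=> Dz; have /andP[x1 x2] := disk_fst Dz; have q0 := qd_gt0 x2.
have c1 : {for z, continuous (@ln R \o qd)}.
  by apply: continuous_comp; [exact: (continuous_pol pol_qd) | exact: continuous_ln].
rewrite /prop_for /continuous_at /lg; apply: cvgB; first exact: cvg_cst.
by apply: cvgMl; exact: c1.
Qed.

Lemma continuous_dirichlet z : D z -> {for z, continuous dirichlet}.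
Proof.
move=> Dz; have /andP[x1 x2] := disk_fst Dz; have q0 := qd_gt0 x2.
have l0 : 0 < lg z by rewrite (lt_le_trans ltr01)// lg_ge1.
have cl := continuous_lg Dz.
have cq : {for z, continuous qd} by exact: (continuous_pol pol_qd).
rewrite /prop_for /continuous_at /dirichlet; apply: cvgV.
  by rewrite mulf_neq0 ?sqrf_eq0 ?gt_eqF.
apply: cvgM; first exact: cq.
by apply: (@cvgM _ _ _ _ lg lg); exact: cl.
Qed.

Lemma measurable_dirichlet : measurable_fun D dirichlet.
Proof.
by apply: open_continuous_measurable2; [exact: open_disk | exact: continuous_dirichlet].
Qed.

Lemma integral_derivative (f F : R -> R) a b : a < b ->
  (forall x, a <= x <= b -> {for x, continuous f}) ->
  (forall x, a <= x <= b -> is_derive x 1 F (f x)) ->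
  (\int[leb]_(x in `[a, b]) (f x)%:E = (F b - F a)%:E)%E.
Proof.
move=> ab cf fF.
have cF x : a <= x <= b -> {for x, continuous F}.
  by move=> /fF[dF _]; apply: differentiable_continuous; exact/derivable1_diffP.
rewrite (@continuous_FTC2 _ f F)//.
- by apply: continuous_in_subspaceT => x; rewrite inE/= in_itv/= => /cf.
- split => [x||].
  + by rewrite in_itv/= => /andP[h1 h2]; case: (fF x); rewrite ?ltW.
  + by apply: cvg_at_right_filter; apply: cF; rewrite lexx ltW.
  + by apply: cvg_at_left_filter; apply: cF; rewrite lexx ltW.
- move=> x; rewrite in_itv/= => /andP[h1 h2]; rewrite derive1E.
  by case: (fF x); rewrite ?ltW.
Qed.

Lemma int_inv_sq u : 0 < u ->
  (\int[leb]_(y in `[(-1)%R, 1%R]) ((u ^+ 2 + y ^+ 2)^-1)%:E <= (pi / u)%:E)%E.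
Proof.
move=> u0; have un0 : u != 0 by rewrite gt_eqF.
have h y : u ^+ 2 + y ^+ 2 != 0 by rewrite gt_eqF//; nra.
have cf y : -1 <= y <= 1 -> {for y, continuous (fun y => (u ^+ 2 + y ^+ 2)^-1)}.
  move=> _; rewrite /prop_for /continuous_at; apply: cvgV => //.
  by apply: cvgD; [exact: cvg_cst | exact: exprn_continuous].
have dF y : -1 <= y <= 1 -> is_derive y 1 (fun y => u^-1 * atan (y * u^-1))
    (u ^+ 2 + y ^+ 2)^-1.
  move=> _; have d1 := isderM (is_derive_id y (1 : R)) (isder_cst u^-1 y 1).
  have d2 := @isder_comp _ _ _ (fun y => y * u^-1) _ _ _ _ (is_derive1_atan (y * u^-1)) d1.
  apply: (is_derive_eq (isderM (isder_cst u^-1 y 1) d2)).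
  have h' : 1 + (y * u^-1) ^+ 2 != 0 by rewrite gt_eqF//; nra.
  by have hy := h y; field; rewrite un0 hy.
have ab : -1 < 1 :> R by lra.
rewrite (integral_derivative ab cf dF) lee_fin -mulrBr mulrC ler_pM2r ?invr_gt0//.
by have := atan_ltpi2 (1 * u^-1); have := atan_gtNpi2 (-1 * u^-1); lra.
Qed.

Lemma isder_la x : x < 1 -> is_derive x (1 : R) la (2 * (1 - x))^-1.
Proof.
move=> x1; have h : 0 < 2 * (1 - x) by lra.
have d1 := isderM (isder_cst 2 x (1 : R))
  (isderD (isder_cst 1 x (1 : R)) (isderN (is_derive_id x (1 : R)))).
have d2 := @isder_comp _ _ _ (fun x => 2 * (1 - x)) _ _ _ _ (is_derive1_ln h) d1.
apply: (is_derive_eq (isderD (isder_cst 3 x 1)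
  (isderN (isderM d2 (isder_cst 2^-1 x 1))))).
by have h' : 1 - x != 0 by [rewrite gt_eqF//; lra]; field.
Qed.

Lemma continuous_inv_la x : -1 <= x < 1 ->
  {for x, continuous (fun x => ((1 - x) * la x ^+ 2)^-1)}.
Proof.
move=> h; have l0 : 0 < la x by apply: (lt_le_trans ltr01); exact: la_ge1.
have x1' : x < 1 by case/andP: h.
have [dl _] := isder_la x1'.
have cl : {for x, continuous la}.
  by apply: differentiable_continuous; exact/derivable1_diffP.
have x1 : 1 - x != 0 by rewrite gt_eqF//; lra.
rewrite /prop_for /continuous_at; apply: cvgV.
  by rewrite mulf_neq0 ?sqrf_eq0 ?gt_eqF//; lra.
apply: cvgM; first by apply: cvgB; [exact: cvg_cst | exact: cvg_id].
by apply: (@cvgM _ _ _ _ la la); exact: cl.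
Qed.

Lemma measurable_inv_la :
  measurable_fun ([set` `](-1)%R, 1%R[] : set T1) (fun x => ((1 - x) * la x ^+ 2)^-1).
Proof.
apply: open_continuous_measurable_fun; first exact: interval_open.
move=> x; rewrite inE/= in_itv/= => /andP[x1 x2]; apply: continuous_inv_la.
by rewrite x2 ltW.
Qed.

(** Since [la] has derivative 1 / (2 (1 - x)), the function -2 / [la] is a primitive, and -2 / [la]
    stays between -2 and 0. The singularity at 1 is reached by exhausting the interval with
    [-1, 1 - 1/(n+1)]. *)
Lemma int_inv_la :
  (\int[leb]_(x in `](-1)%R, 1%R[) (((1 - x) * la x ^+ 2)^-1)%:E <= 2%:E)%E.
Proof.
pose f x : R := ((1 - x) * la x ^+ 2)^-1.
have la0 x : -1 <= x < 1 -> 0 < la x by move=> /la_ge1; lra.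
have cf x : -1 <= x < 1 -> {for x, continuous f} by exact: continuous_inv_la.
have dF x : -1 <= x < 1 -> is_derive x 1 (fun x => - 2 * (la x)^-1) (f x).
  move=> h; have ln0 : la x != 0 by rewrite gt_eqF// la0.
  have dla : is_derive x 1 la (2 * (1 - x))^-1 by apply: isder_la; case/andP: h.
  apply: (is_derive_eq (isderM (isder_cst (-2) x (1 : R)) (isderV ln0 dla))).
  rewrite /f; have h' : 1 - x != 0 by rewrite gt_eqF//; lra.
  by field; rewrite ln0 h'.
pose b n : R := 1 - n.+1%:R^-1.
have b1 n : b n < 1 by rewrite /b ltrBlDr ltrDl invr_gt0.
have b0 n : 0 <= b n by rewrite /b subr_ge0 invf_le1 ?ltr0n// ler1n.
pose F n : set T1 := [set` `[(-1)%R, b n]].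
have sub : [set` `](-1)%R, 1%R[] `<=` \bigcup_n F n.
  move=> x /=; rewrite in_itv/= => /andP[h1 h2].
  have [n hn] := ltr_add_invr h2.
  by exists n => //; rewrite /F/= in_itv/= ltW//= /b lerBrDr ltW.
have mF n : measurable (F n) by exact: measurable_itv.
have Fb n x : F n x -> -1 <= x < 1.
  by rewrite /F/= in_itv/= => /andP[-> h]; rewrite (le_lt_trans h).
have mf n : measurable_fun (F n) (EFin \o f).
  apply/measurable_EFinP; apply: subspace_continuous_measurable_fun; first exact: mF.
  apply: (@continuous_in_subspaceT R R [set` `[(-1)%R, b n]] f) => x.
  by rewrite inE => /Fb /cf.
have f0 x : -1 <= x < 1 -> 0 <= f x.
  by move=> h; rewrite /f invr_ge0 mulr_ge0 ?sqr_ge0//; lra.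
apply: (@le_trans _ _ (\int[leb]_(x in \bigcup_n F n) (f x)%:E)%E).
  apply: ge0_subset_integral => //; first exact: bigcupT_measurable.
  - by apply/measurable_fun_bigcup.
  - by move=> x [n _ /Fb /f0]; rewrite lee_fin.
have := @ge0_nondecreasing_set_cvg_integral _ _ _ F (EFin \o f) leb.
move=> /(_ _ mF mf _); set l := (X in _ --> X) => H.
have {}H : (\int[leb]_(x in F i) (f x)%:E)%E @[i --> \oo] --> l.
  apply: H.
  - move=> m n mn; apply/subsetPset => x; rewrite /F/= !in_itv/= => /andP[-> h] /=.
    by apply: (le_trans h); rewrite /b lerD2l lerN2 lef_pV2 ?posrE// ler_nat.
  - by move=> n x /Fb /f0; rewrite lee_fin.
apply: (cvge_le _ H); apply: nearW => n.
have ab : -1 < b n by have := b0 n; lra.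
have cfn x : -1 <= x <= b n -> {for x, continuous f}.
  by move=> /andP[h1 h2]; apply: cf; rewrite h1 (le_lt_trans h2).
have dFn x : -1 <= x <= b n -> is_derive x 1 (fun x => - 2 * (la x)^-1) (f x).
  by move=> /andP[h1 h2]; apply: dF; rewrite h1 (le_lt_trans h2).
rewrite (integral_derivative ab cfn dFn) lee_fin.
have h1 : 0 < (la (b n))^-1 by rewrite invr_gt0 la0// b1 ltW.
have hm : 1 <= la (-1) by apply: la_ge1; apply/andP; split; lra.
have h2 : (la (-1))^-1 <= 1 by rewrite invf_le1// (lt_le_trans ltr01).
lra.
Qed.

(** Tonelli: at fixed x, the integral in y of 1 / ((1 - x)^2 + y^2) is at most pi / (1 - x), which
    leaves pi / ((1 - x) [la x]^2) to integrate in x. *)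
Lemma integ_dirichlet : integ dirichlet.
Proof.
apply/integrableP; split; first by apply/measurable_EFinP; exact: measurable_dirichlet.
have d0 z : D z -> 0 <= dirichlet z.
  move=> Dz; have /andP[_ x2] := disk_fst Dz.
  by rewrite /dirichlet invr_ge0 mulr_ge0 ?sqr_ge0// ltW// qd_gt0.
pose g z := (dirichlet \_ D) z.
have g0 z : 0 <= g z by rewrite /g patchE; case: ifPn => [/set_mem/d0|].
have mg : measurable_fun [set: T2] (EFin \o g).
  by apply/measurable_EFinP; apply/(measurable_restrictT _ measurable_disk); exact: measurable_dirichlet.
have -> : (\int[mu]_(z in D) `|(EFin \o dirichlet) z| = \int[mu]_z (EFin \o g) z)%E.
  rewrite integral_mkcond; apply: eq_integral => z _ /=.
  rewrite /g !patchE; case: ifPn => // /set_mem Dz.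
  by rewrite ger0_norm// d0.
have gE0 z : (0 <= (EFin \o g) z)%E by rewrite lee_fin.
rewrite /lebesgue2 (fubini_tonelli1 _ mg gE0) /fubini_F /=.
pose K x : R := ((fun x => pi * ((1 - x) * la x ^+ 2)^-1) \_ [set` `](-1)%R, 1%R[]) x.
have inner x : (\int[leb]_y (g (x, y))%:E <= (K x)%:E)%E.
  rewrite /K patchE; case: ifPn => [/set_mem|/negP hx]; last first.
    rewrite integral0_eq// => y _; rewrite /g patchE memNset//.
    by move=> /disk_fst hD; apply: hx; rewrite inE/= in_itv.
  rewrite /= in_itv/= => /andP[x1 x2].
  have u0 : 0 < 1 - x by lra.
  have l0 : 0 < la x by apply: (lt_le_trans ltr01); apply: la_ge1; rewrite ltW.
  pose k y : R := (la x ^+ 2)^-1 * ((1 - x) ^+ 2 + y ^+ 2)^-1.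
  have mk : measurable_fun [set: T1] (fun y : R => ((1 - x) ^+ 2 + y ^+ 2)^-1).
    apply: continuous_measurable_fun => y; apply: cvgV.
      by rewrite gt_eqF//; nra.
    by apply: cvgD; [exact: cvg_cst | exact: exprn_continuous].
  apply: (@le_trans _ _ (\int[leb]_(y in `[(-1)%R, 1%R]) (k y)%:E)%E).
    rewrite [leRHS]integral_mkcond; apply: ge0_le_integral => //.
    - by move=> y _; rewrite lee_fin.
    - by apply: (measurableT_comp mg); exact: measurable_pair1.
    - apply: (measurable_restrictT _ (measurable_itv _)).1; apply/measurable_EFinP.
      by apply: measurable_funTS; apply: measurable_funM.
    - move=> y _; rewrite patchE /g patchE; case: ifPn => [/set_mem Dz|_].
        have := disk_snd Dz => /= /andP[y1 y2].
        rewrite ifT; last by rewrite inE/= in_itv/= !ltW.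
        have l1 := la_le_lg Dz; rewrite /= in l1.
        have q0 : 0 < qd (x, y) by exact: qd_gt0.
        have l2 := lt_le_trans l0 l1.
        have le2 : la x ^+ 2 * qd (x, y) <= qd (x, y) * lg (x, y) ^+ 2.
          rewrite mulrC ler_pM2l//; apply: lerXn2r => //; rewrite nnegrE; exact: ltW.
        rewrite lee_fin /k -[_ + _]/(qd (x, y)) -invfM /dirichlet.
        by rewrite lef_pV2 ?posrE ?mulr_gt0 ?exprn_gt0.
      case: ifPn => _ //; rewrite lee_fin /k mulr_ge0// invr_ge0 ?sqr_ge0//.
      by rewrite addr_ge0 ?sqr_ge0.
  have h0 : (0 <= (la x ^+ 2)^-1) by rewrite invr_ge0 sqr_ge0.
  rewrite (_ : (fun y => (k y)%:E) = fun y => (((la x ^+ 2)^-1)%:E *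
      (((1 - x) ^+ 2 + y ^+ 2)^-1)%:E)%E); last by apply/funext => y; rewrite EFinM.
  rewrite ge0_integralZl//.
  - rewrite (_ : pi * _ = (la x ^+ 2)^-1 * (pi / (1 - x))).
      by rewrite EFinM; apply: lee_wpmul2l; rewrite ?lee_fin//; exact: int_inv_sq.
    by rewrite invfM; ring.
  - by apply/measurable_EFinP; exact: measurable_funTS.
  - by move=> y _; rewrite lee_fin invr_ge0 addr_ge0 ?sqr_ge0.
have mK : measurable_fun [set: T1] (EFin \o K).
  apply/measurable_EFinP; apply: (measurable_restrictT _ (measurable_itv _)).1.
  by apply: measurable_funM => //; exact: measurable_inv_la.
apply: (@le_lt_trans _ _ (\int[leb]_x (K x)%:E)%E).
  apply: ge0_le_integral => //.
  - by move=> x _; apply: integral_ge0 => y _; rewrite lee_fin.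
  - exact: (@measurable_fun_fubini_tonelli_F _ _ T1 T1 R leb (EFin \o g) mg gE0).
apply: (@le_lt_trans _ _ (pi%:E * 2%:E)%E); last by rewrite -EFinM ltry.
rewrite (_ : (\int[leb]_x (K x)%:E = \int[leb]_(x in `](-1)%R, 1%R[)
    (pi%:E * (((1 - x) * la x ^+ 2)^-1)%:E))%E); last first.
  rewrite [RHS]integral_mkcond; apply: eq_integral => x _.
  by rewrite /K !patchE; case: ifPn.
rewrite ge0_integralZl//.
- by apply: lee_wpmul2l; [rewrite lee_fin pi_ge0 | exact: int_inv_la].
- by apply/measurable_EFinP; exact: measurable_inv_la.
- move=> x; rewrite /= in_itv/= => /andP[x1 x2].
  by rewrite lee_fin invr_ge0 mulr_ge0 ?sqr_ge0//; lra.
- by rewrite lee_fin pi_ge0.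
Qed.

End DirichletIntegral.

(** * The harmonic conjugates and their Sobolev regularity *)

Section ConjugatePair.
Context {R : realType}.
Notation T2 := (measurableTypeR R * measurableTypeR R)%type.
Notation mu := (@lebesgue2 R).
Notation D := (@disk R : set T2).
Implicit Types (z v : R * R).

(** In the disk 1 - z lies in the right half-plane, so an arctangent gives its argument. The same
    holds for [bb], because [lg] is positive. *)
Definition ag z : R := atan (z.2 * (1 - z.1)^-1).

Definition md z : R := lg z ^+ 2 + ag z ^+ 2.

Definition phi0 z : R := ln (md z) / 2.

Definition bb z : R := atan (ag z * (lg z)^-1).

(** The complex derivative (log L)' = 1 / ((1 - z) L) equals [dx_phi0] - i [dy_phi0]. *)
Definition dx_phi0 z : R := (lg z * (1 - z.1) + ag z * z.2) * (qd z * md z)^-1.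

Definition dy_phi0 z : R := (ag z * (1 - z.1) - lg z * z.2) * (qd z * md z)^-1.

Lemma disk_facts z : D z -> [/\ 0 < 1 - z.1, 0 < qd z, 1 <= lg z & 1 <= md z].
Proof.
move=> Dz; have /andP[_ x2] := disk_fst Dz; have l1 := lg_ge1 Dz.
by split; [lra | exact: qd_gt0 | | rewrite /md; have := sqr_ge0 (ag z); nra].
Qed.

Lemma isder_lg z v : D z ->
  is_derive z v lg (((1 - z.1) * v.1 - z.2 * v.2) * (qd z)^-1).
Proof.
move=> /disk_facts[u0 q0 _ _]; have d := isder_comp (is_derive1_ln q0) (isder_qd z v).
apply: (is_derive_eq (isderD (isder_cst 3 z v) (isderN (isderM d (isder_cst 2^-1 z v))))).
by have qn : qd z != 0 by [rewrite gt_eqF]; field.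
Qed.

Lemma isder_ag z v : D z ->
  is_derive z v ag ((z.2 * v.1 + (1 - z.1) * v.2) * (qd z)^-1).
Proof.
move=> /disk_facts[u0 q0 _ _]; have un : 1 - z.1 != 0 by rewrite gt_eqF.
have d1 := @isderV _ _ (fun z => 1 - z.1) _ _ _ un (isderD (isder_cst 1 z v) (isderN (isder_fst z v))).
have d2 := @isder_comp _ _ _ (fun z => z.2 * (1 - z.1)^-1) _ _ _ _ (is_derive1_atan _)
  (isderM (isder_snd z v) d1).
apply: (is_derive_eq d2).
have qn : (1 - z.1) ^+ 2 + z.2 ^+ 2 != 0 by rewrite gt_eqF// -/(qd z).
have pn : 1 + (z.2 * (1 - z.1)^-1) ^+ 2 != 0 by rewrite gt_eqF//; nra.
by rewrite /qd; field; rewrite un qn.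
Qed.

Lemma isder_phi0 z v : D z ->
  is_derive z v phi0 (dx_phi0 z * v.1 + dy_phi0 z * v.2).
Proof.
move=> Dz; have [u0 q0 l1 m1] := disk_facts Dz; have m0 : 0 < md z by lra.
have dm := isderD (isderX 2 (isder_lg v Dz)) (isderX 2 (isder_ag v Dz)).
have d := isder_comp (is_derive1_ln m0) dm.
apply: (is_derive_eq (isderM d (isder_cst 2^-1 z v))).
have qn : qd z != 0 by rewrite gt_eqF.
have mn : md z != 0 by rewrite gt_eqF.
by rewrite /dx_phi0 /dy_phi0 /=; set q := qd z in qn *; set m := md z in mn *; field; rewrite mn qn.
Qed.

Lemma isder_bb z v : D z ->
  is_derive z v bb (- dy_phi0 z * v.1 + dx_phi0 z * v.2).
Proof.
move=> Dz; have [u0 q0 l1 m1] := disk_facts Dz; have m0 : 0 < md z by lra.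
have ln0 : lg z != 0 by rewrite gt_eqF//; lra.
have d1 := isderM (isder_ag v Dz) (isderV ln0 (isder_lg v Dz)).
apply: (is_derive_eq (@isder_comp _ _ _ (fun z => ag z * (lg z)^-1) _ _ _ _ (is_derive1_atan _) d1)).
have qn : qd z != 0 by rewrite gt_eqF.
have mn : lg z ^+ 2 + ag z ^+ 2 != 0 by rewrite gt_eqF.
have pn : 1 + (ag z * (lg z)^-1) ^+ 2 != 0 by rewrite gt_eqF//; nra.
rewrite /dx_phi0 /dy_phi0 /md; set q := qd z in qn *; set A := lg z in ln0 mn pn *.
by set B := ag z in mn pn *; field; rewrite ln0 mn qn.
Qed.

Lemma continuous_fst z : {for z, continuous (fun z : R * R => 1 - z.1)}.
Proof. by apply: (continuous_pol (polB (pol_cst 1) (@pol_fst R))). Qed.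

Lemma continuous_snd z : {for z, continuous (fun z : R * R => z.2)}.
Proof. by apply: (continuous_pol (@pol_snd R)). Qed.

Lemma continuous_ag z : D z -> {for z, continuous ag}.
Proof.
move=> /disk_facts[u0 _ _ _].
apply: (@continuous_comp _ _ _ (fun z : R * R => z.2 * (1 - z.1)^-1) (@atan R)); last first.
  exact: continuous_atan.
rewrite /continuous_at; apply: cvgM; first exact: continuous_snd.
by apply: cvgV; [rewrite gt_eqF | exact: continuous_fst].
Qed.

Lemma continuous_md z : D z -> {for z, continuous md}.
Proof.
move=> Dz; have cl := continuous_lg Dz; have ca := continuous_ag Dz.
rewrite /prop_for /continuous_at /md; apply: cvgD.
  by apply: (@cvgM _ _ _ _ lg lg); exact: cl.
by apply: (@cvgM _ _ _ _ ag ag); exact: ca.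
Qed.

Lemma continuous_phi0 z : D z -> {for z, continuous phi0}.
Proof.
move=> Dz; have [_ _ _ m1] := disk_facts Dz.
rewrite /prop_for /continuous_at /phi0; apply: cvgMl.
apply: (@continuous_comp _ _ _ md (@ln R)); first exact: continuous_md.
by apply: continuous_ln; lra.
Qed.

Lemma continuous_bb z : D z -> {for z, continuous bb}.
Proof.
move=> Dz; have [_ _ l1 _] := disk_facts Dz.
apply: (@continuous_comp _ _ _ (fun z : R * R => ag z * (lg z)^-1) (@atan R)); last first.
  exact: continuous_atan.
rewrite /continuous_at; apply: cvgM; first exact: continuous_ag.
by apply: cvgV; [rewrite gt_eqF//; lra | exact: continuous_lg].
Qed.

Lemma continuous_inv_qd_md z : D z -> (qd y * md y)^-1 @[y --> z] --> (qd z * md z)^-1.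
Proof.
move=> Dz; have [_ q0 _ m1] := disk_facts Dz.
apply: cvgV; first by rewrite mulf_neq0 ?gt_eqF//; lra.
by apply: cvgM; [exact: (continuous_pol pol_qd) | exact: continuous_md].
Qed.

Lemma continuous_dx_phi0 z : D z -> {for z, continuous dx_phi0}.
Proof.
move=> Dz; rewrite /prop_for /continuous_at /dx_phi0.
apply: cvgM; last exact: continuous_inv_qd_md.
apply: cvgD; apply: cvgM; [exact: continuous_lg | exact: continuous_fst |
  exact: continuous_ag | exact: continuous_snd].
Qed.

Lemma continuous_dy_phi0 z : D z -> {for z, continuous dy_phi0}.
Proof.
move=> Dz; rewrite /prop_for /continuous_at /dy_phi0.
apply: cvgM; last exact: continuous_inv_qd_md.
apply: cvgB; apply: cvgM; [exact: continuous_ag | exact: continuous_fst |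
  exact: continuous_lg | exact: continuous_snd].
Qed.

Lemma grad_phi0_sq z : D z -> dx_phi0 z ^+ 2 + dy_phi0 z ^+ 2 <= dirichlet z.
Proof.
move=> Dz; have [u0 q0 l1 m1] := disk_facts Dz; have m0 : 0 < md z by lra.
have -> : dx_phi0 z ^+ 2 + dy_phi0 z ^+ 2 = (qd z * md z)^-1.
  have qn : (1 - z.1) ^+ 2 + z.2 ^+ 2 != 0 by rewrite gt_eqF// -/(qd z).
  have mn : lg z ^+ 2 + ag z ^+ 2 != 0 by rewrite gt_eqF.
  rewrite /dx_phi0 /dy_phi0 /md /qd; set A := lg z in mn *; set B := ag z in mn *.
  by field; rewrite mn qn.
have l20 : 0 < lg z ^+ 2 by rewrite exprn_gt0//; lra.
have p1 := mulr_gt0 q0 m0; have p2 := mulr_gt0 q0 l20.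
rewrite /dirichlet lef_pV2 ?posrE//.
by rewrite ler_pM2l// /md lerDl sqr_ge0.
Qed.

Lemma atan_sq_le (x : R) : atan x ^+ 2 <= pi ^+ 2.
Proof.
have := atan_ltpi2 x; have := atan_gtNpi2 x; have := @pi_ge0 R; nra.
Qed.

Lemma phi0_ge0 z : D z -> 0 <= phi0 z.
Proof. by move=> /disk_facts[_ _ _ m1]; rewrite /phi0 divr_ge0// ln_ge0. Qed.

(** |L| is at least its real part, hence at least [la]. The bound sees only the abscissa, as do the
    weights (1 + x)^n. *)
Lemma phi0_ge_ln z : D z -> ln (la z.1) <= phi0 z.
Proof.
move=> Dz; have [u0 q0 l1 m1] := disk_facts Dz; have l2 := la_le_lg Dz.
have la1 : 1 <= la z.1 by apply: la_ge1; have /andP[h ->] := disk_fst Dz; rewrite ltW.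
have s : la z.1 ^+ 2 <= md z.
  apply: (@le_trans _ _ (lg z ^+ 2)); last by rewrite /md lerDl sqr_ge0.
  by apply: lerXn2r => //; rewrite nnegrE; lra.
have la0 : 0 < la z.1 by lra.
have m0 : 0 < md z by lra.
by rewrite /phi0 ler_pdivlMr// mulr_natr -lnXn// ler_ln ?posrE// exprn_gt0.
Qed.

(* [qd * exp (2 lg) = exp 6]: the singularity of [dirichlet] is exponential in [lg],
   that of [phi0] at most polynomial. *)
Lemma phi0_le z : D z -> phi0 z <= (1 + pi ^+ 2) * expR 6 * dirichlet z.
Proof.
move=> Dz; have [u0 q0 l1 m1] := disk_facts Dz; have m0 : 0 < md z by lra.
have E : expR (2 * lg z) * qd z = expR 6.
  rewrite (_ : 2 * lg z = 6 - ln (qd z)); last by rewrite /lg; field.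
  by rewrite expRD expRN lnK ?posrE// divfK// gt_eqF.
(* The Taylor term of degree 4, with 24 = 4!: [phi0 z * lg z ^+ 2] is at most ([lg z]^2 + pi^2)
   [lg z]^2 / 2, of degree 4 in [lg z]. *)
have h4 : (2 * lg z) ^+ 4 <= 24 * expR (2 * lg z).
  by have := @expr_le_expR R 4 (2 * lg z); apply; lra.
have hm : md z <= lg z ^+ 2 + pi ^+ 2 by rewrite /md lerD2l atan_sq_le.
have hp : phi0 z <= md z / 2 by rewrite /phi0 ler_pM2r// ltW// ln_sublinear.
have l20 : 0 < lg z ^+ 2 by rewrite exprn_gt0//; lra.
have key : phi0 z * lg z ^+ 2 <= (1 + pi ^+ 2) * expR (2 * lg z).
  apply: (@le_trans _ _ ((lg z ^+ 2 + pi ^+ 2) / 2 * lg z ^+ 2)).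
    by apply: ler_wpM2r; [exact: ltW | apply: (le_trans hp); rewrite ler_pM2r].
  have e2 : lg z ^+ 2 <= lg z ^+ 4 by apply: ler_weXn2l.
  have e4 : (2 * lg z) ^+ 4 = 16 * lg z ^+ 4 by ring.
  have -> : (lg z ^+ 2 + pi ^+ 2) / 2 * lg z ^+ 2 =
    (lg z ^+ 4 + pi ^+ 2 * lg z ^+ 2) / 2 by field.
  have e3 : lg z ^+ 4 <= 2 * expR (2 * lg z).
    by rewrite e4 in h4; have := expR_gt0 (2 * lg z); lra.
  have p0 : 0 <= (pi : R) ^+ 2 by exact: sqr_ge0.
  have := ler_wpM2l p0 (le_trans e2 e3); nra.
have p2 := mulr_gt0 q0 l20.
rewrite /dirichlet ler_pdivlMr// -E.
rewrite (_ : phi0 z * (qd z * lg z ^+ 2) = phi0 z * lg z ^+ 2 * qd z); last by ring.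
by rewrite mulrA ler_pM2r.
Qed.

Lemma integ_phi0 : integ phi0.
Proof.
apply: (integ_le _ (integZ ((1 + pi ^+ 2) * expR 6) integ_dirichlet)).
  by apply: open_continuous_measurable2; [exact: open_disk | exact: continuous_phi0].
by move=> z Dz; rewrite ger0_norm ?phi0_ge0// phi0_le.
Qed.

Lemma W1p_bb : W1p_gradient 2%:E bb (fun z => - dy_phi0 z) dx_phi0.
Proof.
have od := @open_disk R.
have cdy z : D z -> {for z, continuous (fun z => - dy_phi0 z)}.
  by move=> /continuous_dy_phi0 c; exact: cvgN.
split.
- apply: (Lp_disk2_le _ (integ_cst (pi ^+ 2))).
    by apply: open_continuous_measurable2 => //; exact: continuous_bb.
  by move=> z _; exact: atan_sq_le.
- apply: (Lp_disk2_le _ integ_dirichlet).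
    by apply: open_continuous_measurable2.
  move=> z Dz; rewrite sqrrN; apply: le_trans (grad_phi0_sq Dz).
  by rewrite lerDr sqr_ge0.
- apply: (Lp_disk2_le _ integ_dirichlet).
    by apply: open_continuous_measurable2 => //; exact: continuous_dx_phi0.
  by move=> z Dz; apply: le_trans (grad_phi0_sq Dz); rewrite lerDl sqr_ge0.
- apply: weak_derivative_classical => //; first by left.
    exact: continuous_bb.
  by move=> z Dz; apply: (is_derive_eq (isder_bb e1 Dz)); rewrite /e1 /=; ring.
- apply: weak_derivative_classical; [by right | exact: continuous_bb |
    exact: continuous_dx_phi0 |].
  by move=> z Dz; apply: (is_derive_eq (isder_bb e2 Dz)); rewrite /e2 /=; ring.
Qed.

Lemma W1p_phi0 m : W1p_gradient 1 (fun z => phi0 z - m) dx_phi0 dy_phi0.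
Proof.
have od := @open_disk R.
have cphi z : D z -> {for z, continuous (fun z => phi0 z - m)}.
  by move=> /continuous_phi0 c; apply: cvgB; [exact: c | exact: cvg_cst].
(* Each partial derivative g satisfies |g| <= 1 + g^2. *)
have i1 : integ (fun z : R * R => 1 + dirichlet z).
  by apply: integD; [exact: integ_cst | exact: integ_dirichlet].
have d v z : D z -> is_derive z v (fun z => phi0 z - m) (dx_phi0 z * v.1 + dy_phi0 z * v.2).
  move=> Dz; apply: (is_derive_eq (isderD (isder_phi0 v Dz) (isder_cst (- m) z v))).
  by rewrite addr0.
split.
- by apply/Lp_disk1P; apply: integB; [exact: integ_phi0 | exact: integ_cst].
- apply/Lp_disk1P; apply: (integ_le _ i1).
    by apply: open_continuous_measurable2 => //; exact: continuous_dx_phi0.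
  move=> z Dz; have := grad_phi0_sq Dz; have := sqr_ge0 (dy_phi0 z).
  by rewrite ler_norml => *; apply/andP; split; nra.
- apply/Lp_disk1P; apply: (integ_le _ i1).
    by apply: open_continuous_measurable2 => //; exact: continuous_dy_phi0.
  move=> z Dz; have := grad_phi0_sq Dz; have := sqr_ge0 (dx_phi0 z).
  by rewrite ler_norml => *; apply/andP; split; nra.
- apply: weak_derivative_classical; [by left | exact: cphi | exact: continuous_dx_phi0 |].
  by move=> z Dz; apply: (is_derive_eq (d e1 z Dz)); rewrite /e1 /=; ring.
- apply: weak_derivative_classical; [by right | exact: cphi | exact: continuous_dy_phi0 |].
  by move=> z Dz; apply: (is_derive_eq (d e2 z Dz)); rewrite /e2 /=; ring.
Qed.

End ConjugatePair.

(** * Moments of solutions and unboundedness *)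

Section Uniqueness.
Context {R : realType}.
Notation T2 := (measurableTypeR R * measurableTypeR R)%type.
Notation mu := (@lebesgue2 R).
Notation D := (@disk R : set T2).
Notation aa := ((fun=> -1) : R * R -> R).
Implicit Types (phi f g : R * R -> R) (z : R * R).

Definition phi0_mean : R := \int[mu]_(z in D) phi0 z / fine (mu D).

Lemma fine_disk_gt0 : 0 < fine (mu D).
Proof.
apply: fine_gt0; rewrite lebesgue2_disk_lty andbT.
apply: (@lebesgue2_box_gt0 _ D 0 2^-1 0 2^-1); rewrite ?invr_gt0//.
  exact: measurable_disk.
by move=> z; rewrite /disk /= !in_itv/= => -[/andP[? ?] /andP[? ?]]; nra.
Qed.

Lemma neumann_solution_phi0 : neumann_solution aa bb (fun z => phi0 z - phi0_mean).
Proof.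
exists (fun z => - dy_phi0 z), dx_phi0, dx_phi0, dy_phi0.
split; [exact: W1p_bb | exact: W1p_phi0 | |].
  rewrite RintegralB; [|exact: measurable_disk|exact: integ_phi0|exact: integ_cst].
  rewrite Rintegral_cst; last exact: measurable_disk.
  by rewrite /phi0_mean divfK ?subrr// gt_eqF// fine_disk_gt0.
move=> v _; rewrite (@eq_Rintegral _ _ _ mu D (fun=> 0)).
  by rewrite Rintegral_cst ?mul0r//; exact: measurable_disk.
by move=> z _; ring.
Qed.

Lemma neumann_solution_moment phi1 phi2 n :
  neumann_solution aa bb phi1 -> neumann_solution aa bb phi2 ->
  \int[mu]_(z in D) (phi1 z * (1 + z.1) ^+ n) =
  \int[mu]_(z in D) (phi2 z * (1 + z.1) ^+ n).
Proof.
have [v [h [d [pv ph E L]]]] := @neumann_polynomial R n.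
have mD := @measurable_disk R.
have p1 := polDer e1 pv; have p2 := polDer e2 pv.
have [_ /Lp_disk2_integ ib1 /Lp_disk2_integ ib2 wb1 wb2] := @W1p_bb R.
have cX : continuous (fun z : R * R => (1 + z.1) ^+ n).
  apply: continuous_pol; apply: polX; apply: polD; first exact: pol_cst.
  exact: pol_fst.
(* The right-hand side involves only [bb] and [v], not the solution. *)
suff key phi : neumann_solution aa bb phi ->
  \int[mu]_(z in D) (phi z * (1 + z.1) ^+ n) =
  - (\int[mu]_(z in D) (dx_phi0 z * 'D_e1 v z) -
     \int[mu]_(z in D) (- dy_phi0 z * 'D_e2 v z)).
  by move=> s1 s2; rewrite !key.
move=> [c1 [c2 [g1 [g2 [[_ Lc1 Lc2 wc1 wc2] [L0 Lg1 Lg2 wg1 wg2] mean eqn]]]]].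
have ic1 := Lp_disk2_integ Lc1; have ic2 := Lp_disk2_integ Lc2.
have i0 := (Lp_disk1P _).1 L0.
have i1 := (Lp_disk1P _).1 Lg1; have i2 := (Lp_disk1P _).1 Lg2.
have iw f e : integ f -> integ (fun z => f z * 'D_e v z).
  by move=> fi; apply: integ_continuous => //; apply: continuous_pol; exact: polDer.
rewrite (weak_derivative_unique wb2 wc2 ib2 ic2 p1).
rewrite (weak_derivative_unique wb1 wc1 ib1 ic1 p2).
have hW z : 'D_e1 v z * z.1 + 'D_e2 v z * z.2 = - (rim z * h z).
  by rewrite -E /euler /pd; ring.
have green := weak_divergence i0 i1 i2 wg1 wg2 p1 p2 ph hW.
have split_eqn : \int[mu]_(z in D) (g1 z * 'D_e1 v z) +
    \int[mu]_(z in D) (g2 z * 'D_e2 v z) =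
    \int[mu]_(z in D) (c2 z * 'D_e1 v z) - \int[mu]_(z in D) (c1 z * 'D_e2 v z).
  have j1 := iw g1 e1 i1; have j2 := iw g2 e2 i2.
  have j3 := iw c2 e1 ic2; have j4 := iw c1 e2 ic1.
  rewrite -(RintegralD mD j1 j2) -(RintegralB mD j3 j4).
  apply: subr0_eq; rewrite -(RintegralB mD (integD j1 j2) (integB j3 j4)).
  rewrite -[RHS](eqn v (smooth_pol pv)).
  by apply: eq_Rintegral => z _; ring.
rewrite -split_eqn green opprK.
rewrite [RHS](@eq_Rintegral _ _ _ mu D (fun z => phi z * (1 + z.1) ^+ n - phi z * d)); last first.
  by move=> z _; rewrite -mulrBr -(L z) /lap /pd.
rewrite RintegralB//; last 2 first.
- exact: integ_continuous.
- by apply: integ_continuous => // z; exact: cvg_cst.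
(* The constant [d] in the Laplacian of [v] is paired with the mean of the solution, which is 0. *)
by rewrite RintegralZr// mean mul0r subr0.
Qed.

Lemma Rintegral_ae_ge0 f : integ f -> {ae mu, forall z, D z -> 0 <= f z} ->
  0 <= \int[mu]_(z in D) f z.
Proof.
move=> fi f0; rewrite (_ : \int[mu]_(z in D) f z = \int[mu]_(z in D) `|f z|).
  exact: Rintegral_ge0.
congr fine; have mf := integ_meas fi; apply: ae_eq_integral => //.
- exact: measurable_disk.
- by apply/measurable_EFinP.
- by apply/measurable_EFinP; apply: measurableT_comp.
- have [N [mN N0 sub]] := f0; exists N; split => // z nz; apply: sub => h; apply: nz.
  by move=> Dz; rewrite /= ger0_norm// h.
Qed.

Lemma phi0_large (M : R) : exists2 t : R, 0 < t <= 1 &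
  forall z, D z -> 1 - t < z.1 -> M <= phi0 z.
Proof.
(* [E] is the value of 2 (1 - x) at which [la x] equals [expR M]. *)
pose E := expR (2 * (3 - expR M)).
exists (Num.min 1 (E / 2)).
  by rewrite lt_min ltr01 divr_gt0 ?expR_gt0//= ge_min lexx.
move=> z Dz hz; apply: le_trans (phi0_ge_ln Dz).
have /andP[x1 x2] := disk_fst Dz.
have la0 : 0 < la z.1 by apply: (lt_le_trans ltr01); apply: la_ge1; rewrite ltW.
rewrite -[M]expRK ler_ln ?posrE ?expR_gt0//.
have u0 : 0 < 2 * (1 - z.1) by lra.
have uE : 2 * (1 - z.1) <= E.
  have : 1 - z.1 < E / 2; last by lra.
  by apply: (@lt_le_trans _ _ (Num.min 1 (E / 2))); [lra | rewrite ge_min lexx orbT].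
have : ln (2 * (1 - z.1)) <= ln E by rewrite ler_ln ?posrE// expR_gt0.
by rewrite /E expRK /la; lra.
Qed.

(** Rescaled to r = (1 + x) / (2 - t), the weight exceeds 1 exactly for x > 1 - t, where the known
    solution exceeds [phi] by at least 1 almost everywhere. There the difference times r^n grows at
    least like n (r - 1); elsewhere it is at least [- C]. Its integral is 0 for every n, which is
    impossible for n large. *)
Lemma neumann_solution_unbounded phi : neumann_solution aa bb phi ->
  ~ Lp_disk +oo%E phi.
Proof.
move=> sol /Lp_disky_bounded[M aeM]; have mD := @measurable_disk R.
(* The threshold leaves a gap of 1 between [phi0 - phi0_mean] and the bound [M] on [phi]. *)
have [t /andP[t0 t1] large] := phi0_large (M + 1 + phi0_mean).
pose C : R := `|M| + `|phi0_mean|.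
pose c : R := (2 - t)^-1.
have c0 : 0 < c by rewrite invr_gt0; lra.
have ct : c * (2 - t) = 1 by rewrite mulVf// gt_eqF//; lra.
pose r z : R := c * (1 + z.1).
(* The positive part of r - 1, written so that continuity is immediate. *)
pose s z : R := (r z - 1 + `|r z - 1|) / 2.
have cr : continuous r.
  by apply: continuous_pol; apply: polM; [exact: pol_cst |
    apply: polD; [exact: pol_cst | exact: pol_fst]].
have cs : continuous s.
  have cr1 : continuous (fun z => r z - 1).
    by move=> z; apply: cvgB; [exact: cr | exact: cvg_cst].
  move=> z; apply: cvgMl; apply: cvgD; first exact: cr1.
  by apply: cvg_norm; exact: cr1.
have s_le z : r z <= 1 -> s z = 0.
  by move=> h; rewrite /s ler0_norm ?subr_le0// subrr mul0r.
have s_gt z : 1 <= r z -> s z = r z - 1.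
  by move=> h; rewrite /s ger0_norm ?subr_ge0//; field.
have s_ge0 z : 0 <= s z.
  by have [/s_le ->//|h] := leP (r z) 1; rewrite s_gt ?subr_ge0 ltW.
have icont f : continuous f -> integ f.
  move=> cf; rewrite (_ : f = fun z => 1 * f z).
    by apply: integ_continuous => //; exact: integ_cst.
  by apply/funext => z; rewrite mul1r.
have is' := icont _ cs.
have [_ [_ [_ [_ [_ [L0 _ _ _ _] _ _]]]]] := sol.
have i0 := (Lp_disk1P _).1 L0.
have ip : integ (fun z => phi0 z - phi0_mean).
  by apply: integB; [exact: integ_phi0 | exact: integ_cst].
have cX n : continuous (fun z : R * R => (1 + z.1) ^+ n).
  apply: continuous_pol; apply: polX; apply: polD; first exact: pol_cst.
  exact: pol_fst.
pose F n z : R := (c ^+ n) * ((phi0 z - phi0_mean) * (1 + z.1) ^+ n -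
  phi z * (1 + z.1) ^+ n).
have i1 n := integ_continuous ip (cX n); have i2 n := integ_continuous i0 (cX n).
have iF n : integ (F n) by apply: integZ; exact: integB.
have intF n : \int[mu]_(z in D) F n z = 0.
  rewrite (RintegralZl _ mD (integB (i1 n) (i2 n))) (RintegralB mD (i1 n) (i2 n)).
  have /= eq_n := neumann_solution_moment n neumann_solution_phi0 sol.
  by apply/eqP; rewrite mulf_eq0 subr_eq0; apply/orP; right; apply/eqP.
have iG n : integ (fun z => n%:R * s z - C).
  by apply: integB; [exact: integZ | exact: integ_cst].
have lower n : {ae mu, forall z, D z -> 0 <= F n z - (n%:R * s z - C)}.
  have [N [mN N0 sub]] := aeM; exists N; split => // z nz; apply: sub => hM; apply: nz.
  move=> Dz; have {}hM := hM Dz.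
  have /andP[x1 x2] := disk_fst Dz.
  have r0 : 0 <= r z by rewrite mulr_ge0 ?ltW//; lra.
  have -> : F n z = (phi0 z - phi0_mean - phi z) * r z ^+ n.
    by rewrite /F /r exprMn; ring.
  have p0 := phi0_ge0 Dz; have hp := ler_norm phi0_mean; have hM2 := ler_norm M.
  have /andP[m1 m2] : - M <= phi z <= M by rewrite -ler_norml.
  rewrite subr_ge0; have [h|h] := leP (r z) 1.
    rewrite s_le//.
    have rn1 : r z ^+ n <= 1 by rewrite exprn_ile1.
    have rn0 : 0 <= r z ^+ n by rewrite exprn_ge0.
    have : - C <= phi0 z - phi0_mean - phi z by rewrite /C; lra.
    have : 0 <= C by rewrite addr_ge0.
    by rewrite mulr0; nra.
  rewrite s_gt; last exact: ltW.
  have hx : 1 - t < z.1.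
    have : c * (2 - t) < c * (1 + z.1) by rewrite ct.
    by rewrite ltr_pM2l//; lra.
  have l1 := large z Dz hx.
  (* Bernoulli's inequality: linear growth in [n] is enough against the fixed bound [C]. *)
  have bern : 1 + n%:R * (r z - 1) <= r z ^+ n.
    elim: (n) => [|k IH]; first by rewrite mul0r addr0 expr0.
    have k0 : 0 <= k%:R :> R by rewrite ler0n.
    rewrite exprS; apply: le_trans (ler_wpM2l r0 IH); rewrite -subr_ge0.
    rewrite (_ : _ - _ = k%:R * (r z - 1) ^+ 2); first by rewrite mulr_ge0 ?sqr_ge0.
    by rewrite -[k.+1]addn1 natrD; ring.
  have rn0 : 0 <= r z ^+ n by rewrite exprn_ge0.
  have C0 : 0 <= C by rewrite addr_ge0.
  by nra.
have bound n : n%:R * \int[mu]_(z in D) s z <= C * fine (mu D).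
  have := Rintegral_ae_ge0 (integB (iF n) (iG n)) (lower n).
  rewrite (RintegralB mD (iF n) (iG n)) intF.
  rewrite (RintegralB mD (integZ n%:R is') (integ_cst C)) (RintegralZl _ mD is').
  by rewrite (Rintegral_cst mu mD); lra.
have int_s : 0 < \int[mu]_(z in D) s z.
  (* A box inside the disk on which x > 1 - t/2, so that r - 1 is at least c t / 2. *)
  pose B : set T2 := `](1 - t / 2), (1 - t / 4)[ `*` `](- (t / 4)), (t / 4)[.
  have mB : measurable B by exact: measurableX.
  have BD : B `<=` D.
    by move=> z; rewrite /B /disk /= !in_itv/= => -[/andP[? ?] /andP[? ?]]; nra.
  have B0 : (0 < mu B)%E.
    by apply: (@lebesgue2_box_gt0 _ B (1 - t / 2) (1 - t / 4) (- (t / 4)) (t / 4)) => //; lra.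
  have Bfin : (mu B < +oo)%E.
    apply: le_lt_trans (lebesgue2_disk_lty).
    by apply: le_measure => //; rewrite inE.
  have k0 : 0 < c * (t / 2) by rewrite mulr_gt0//; lra.
  apply: (@lt_le_trans _ _ (\int[mu]_(z in B) (c * (t / 2)))).
    rewrite Rintegral_cst// mulr_gt0//; apply: fine_gt0.
    by rewrite B0 Bfin.
  apply: (@le_trans _ _ (\int[mu]_(z in B) s z)).
    apply: le_Rintegral => //.
    - by apply: integrableS (integ_cst (c * (t / 2))).
    - by apply: integrableS is'.
    - move=> z; rewrite /B /= !in_itv/= => -[/andP[h1 h2] _].
      have hr : c * (t / 2) <= r z - 1 by rewrite /r -[X in _ - X]ct -mulrBr ler_pM2l//; lra.
      by rewrite s_gt//; lra.
  rewrite (Rintegral_mkcond mu B) (Rintegral_mkcond mu D).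
  apply: le_Rintegral => //.
  - rewrite -restrict_EFin; apply: (integrable_mkcond _ mB).1.
    by apply: integrableS is'.
  - by rewrite -restrict_EFin; apply: (integrable_mkcond _ mD).1.
  - move=> z _; rewrite !patchE; case: ifPn => [/set_mem/BD Dz|_].
      by rewrite mem_set.
    by case: ifPn => _ //; exact: s_ge0.
have C0 : 0 <= C * fine (mu D).
  by rewrite mulr_ge0 ?addr_ge0// ltW// fine_disk_gt0.
have := archi_boundP (divr_ge0 C0 (ltW int_s)).
rewrite ltr_pdivrMr// ltNge => /negP; apply; exact: bound.
Qed.

End Uniqueness.

Theorem theorem1p4 (R : realType) :
  exists a b : R * R -> R,
    [/\ Lp_disk +oo%E a, W1p 2%:E a, Lp_disk +oo%E b & W1p 2%:E b] /\
    (exists phi : R * R -> R, neumann_solution a b phi) /\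
    (forall phi : R * R -> R, neumann_solution a b phi -> ~ Lp_disk +oo%E phi).
Proof.
have mc (c : R) : measurable_fun (disk : set (measurableTypeR R * measurableTypeR R)) (fun=> c).
  exact: measurable_cst.
have weak_cst (e : R * R) : e = e1 \/ e = e2 -> weak_derivative e (fun=> -1) (fun=> 0).
  have cc (k : R) (z : R * R) : {for z, continuous (fun=> k)} by exact: cvg_cst.
  move=> he; exact: (weak_derivative_classical he (fun z _ => cc (-1) z)
    (fun z _ => cc 0 z) (fun z _ => isder_cst (-1) z e)).
exists (fun=> -1), bb; split; last first.
  split; first by exists (fun z => phi0 z - phi0_mean); exact: neumann_solution_phi0.
  exact: neumann_solution_unbounded.
split.
- by apply: (@Lp_disky_le _ _ 1) => // z _; rewrite normrN1.
- exists (fun=> 0), (fun=> 0); split.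
  + by apply: (Lp_disk2_le _ (integ_cst 1)) => // z _; rewrite sqrrN expr1n.
  + by apply: (Lp_disk2_le _ (integ_cst 0)) => // z _; rewrite expr0n.
  + by apply: (Lp_disk2_le _ (integ_cst 0)) => // z _; rewrite expr0n.
  + by apply: weak_cst; left.
  + by apply: weak_cst; right.
- apply: (@Lp_disky_le _ _ pi).
    apply: open_continuous_measurable2; [exact: open_disk | exact: continuous_bb].
  move=> z _; have p0 := @pi_ge0 R; have := atan_sq_le (ag z * (lg z)^-1).
  by rewrite -/(bb z) -[bb z ^+ 2]real_normK ?num_real// ler_pXn2r// nnegrE.
- by exists (fun z => - dy_phi0 z), dx_phi0; exact: W1p_bb.
Qed.
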